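(* Let $r>0$ and let $\mathcal{B}_r=\{\varphi_{(r,h)}:h\in\mathbb{S}^3\}\simeq\mathbb{RP}^3$ be the isometric class of $\mathrm{Sp}(2)$-invariant $\mathrm{G}_2$-structures on $\mathbb{S}^7=\mathrm{Sp}(2)/\mathrm{Sp}(1)$ inducing $g_r$. The indices of harmonic $\mathrm{G}_2$-structures in $\mathcal{B}_r$, as critical points of $E$, satisfy the following lower bounds. If $r<1$: the harmonic $\mathrm{G}_2$-structures on $\{r\}\times\mathbb{RP}^2$, with $\mathbb{RP}^2=\{[(h_0,h_1,0,h_3)]\}$, have index at least $1$ and hence are unstable. If $r>1$: the harmonic $\mathrm{G}_2$-structures on $\{r\}\times\mathrm{NS}$, with $\mathrm{NS}=[(0,0,\pm1,0)]$, have index at least $3$ and hence are unstable.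
   Context: $\mathrm{Sp}(1)\subset\mathrm{Sp}(2)$ via $h\mapsto\mathrm{diag}(h,1)$; $\mathbb{S}^7=\mathrm{Sp}(2)/\mathrm{Sp}(1)$; $\mathfrak{p}=\mathfrak{sp}(1)^\perp\simeq T_o\mathbb{S}^7$ has basis $e_1=\mathrm{diag}(0,i)$, $e_2=\mathrm{diag}(0,j)$, $e_3=\mathrm{diag}(0,k)$, $e_4=\frac1{\sqrt2}\begin{pmatrix}0&i\\ i&0\end{pmatrix}$, $e_5=\frac1{\sqrt2}\begin{pmatrix}0&j\\ j&0\end{pmatrix}$, $e_6=\frac1{\sqrt2}\begin{pmatrix}0&k\\ k&0\end{pmatrix}$, $e_7=\frac1{\sqrt2}\begin{pmatrix}0&1\\-1&0\end{pmatrix}$, dual basis $e^i$; $\omega_1=e^{47}+e^{56}$, $\omega_2=e^{46}-e^{57}$, $\omega_3=e^{45}+e^{67}$. Invariant tensors on $\mathbb{S}^7$ are identified with $\mathrm{Ad}(\mathrm{Sp}(1))$-invariant tensors on $\mathfrak{p}$, and for invariant $1$-forms $d\alpha(X,Y)=-\alpha([X,Y]_{\mathfrak p})$. For $h=(h_0,h_1,h_2,h_3)\in\mathbb{S}^3$, $\varphi_{(r,h)}=r^3e^{123}+\sum_{i,l=1}^3\Upsilon(h)_{il}\,e^l\wedge\omega_i$, with $$\Upsilon(h)=\begin{pmatrix}h_0^2+h_1^2-h_2^2-h_3^2&2(h_1h_2-h_0h_3)&2(h_1h_3+h_0h_2)\\2(h_1h_2+h_0h_3)&h_0^2-h_1^2+h_2^2-h_3^2&2(h_2h_3-h_0h_1)\\2(h_1h_3-h_0h_2)&2(h_2h_3+h_0h_1)&h_0^2-h_1^2-h_2^2+h_3^2\end{pmatrix};$$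 it depends only on $[h]=\{\pm h\}$, is identified with $(r,[h])$, and induces $g_r=r^2\sum_{i\le3}(e^i)^2+\frac1r\sum_{i\ge4}(e^i)^2$. The full torsion tensor $T$ of $\varphi$, with $\psi=*\varphi$, is given by $\nabla_i\varphi_{jkl}=T_i{}^m\psi_{mjkl}$. The Dirichlet energy is $E(\varphi)=\frac12\int_{\mathbb{S}^7}|T_\varphi|^2\mathrm{vol}_\varphi$, considered on $\mathrm{G}_2$-structures (not necessarily invariant) inducing the same metric and orientation; its critical points are the harmonic $\mathrm{G}_2$-structures ($\mathrm{div}\,T=0$). Infinitesimal isometric variations of $\varphi$ have the form $V\lrcorner\psi$ with $V\in\mathfrak{X}(\mathbb{S}^7)$, and at a critical point $\mathrm{Hess}(E)$ is the second-variation bilinear form of $E$ on $\mathfrak{X}(\mathbb{S}^7)$. The index is the dimension of the largest subspace of $\mathfrak{X}(\mathbb{S}^7)$ on which $\mathrm{Hess}(E)$ is negative definite; a harmonic $\mathrm{G}_2$-structure is unstable if its index is positive. *)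

(* Defs.v *)
From HB Require Import structures.
From mathcomp Require Import all_boot all_order all_algebra.
From mathcomp Require Import all_classical all_reals all_analysis.
From mathcomp Require Import ring.
Set Implicit Arguments.
Unset Strict Implicit.
Unset Printing Implicit Defensive.
Import Order.TTheory GRing.Theory Num.Theory.
Import numFieldNormedType.Exports.
Local Open Scope classical_set_scope.
Local Open Scope ring_scope.

Record quat (R : Type) := Quat { q0 : R; q1 : R; q2 : R; q3 : R }.

Section QuatRing.
Variable R : realType.
Implicit Types x y z : quat R.

Definition quat_tuple x := (q0 x, q1 x, q2 x, q3 x).
Definition tuple_quat (p : R * R * R * R) : quat R :=
  Quat p.1.1.1 p.1.1.2 p.1.2 p.2.
Lemma quat_tupleK : cancel quat_tuple tuple_quat. Proof. by case. Qed.
HB.instance Definition _ := Equality.copy (quat R) (can_type quat_tupleK).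
HB.instance Definition _ := Choice.copy (quat R) (can_type quat_tupleK).

Definition quat_add x y :=
  Quat (q0 x + q0 y) (q1 x + q1 y) (q2 x + q2 y) (q3 x + q3 y).
Definition quat_opp x := Quat (- q0 x) (- q1 x) (- q2 x) (- q3 x).
Definition quat_mul x y :=
  Quat (q0 x * q0 y - q1 x * q1 y - q2 x * q2 y - q3 x * q3 y)
       (q0 x * q1 y + q1 x * q0 y + q2 x * q3 y - q3 x * q2 y)
       (q0 x * q2 y - q1 x * q3 y + q2 x * q0 y + q3 x * q1 y)
       (q0 x * q3 y + q1 x * q2 y - q2 x * q1 y + q3 x * q0 y).
Definition quat_one : quat R := Quat 1 0 0 0.

Fact quat_addA : associative quat_add.
Proof. by move=> x y z; congr Quat => /=; ring. Qed.
Fact quat_addC : commutative quat_add.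
Proof. by move=> x y; congr Quat => /=; ring. Qed.
Fact quat_add0 : left_id (Quat 0 0 0 0) quat_add.
Proof. by case=> *; congr Quat => /=; ring. Qed.
Fact quat_addN : left_inverse (Quat 0 0 0 0) quat_opp quat_add.
Proof. by move=> x; congr Quat => /=; ring. Qed.
HB.instance Definition _ :=
  GRing.isZmodule.Build (quat R) quat_addA quat_addC quat_add0 quat_addN.

Fact quat_mulA : associative quat_mul.
Proof. by move=> x y z; congr Quat => /=; ring. Qed.
Fact quat_mul1l : left_id quat_one quat_mul.
Proof. by case=> *; congr Quat => /=; ring. Qed.
Fact quat_mul1r : right_id quat_one quat_mul.
Proof. by case=> *; congr Quat => /=; ring. Qed.
Fact quat_mulDl : left_distributive quat_mul +%R.
Proof. by move=> x y z; congr Quat => /=; ring. Qed.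
Fact quat_mulDr : right_distributive quat_mul +%R.
Proof. by move=> x y z; congr Quat => /=; ring. Qed.
Fact quat_oner_neq0 : quat_one != 0 :> quat R.
Proof. by apply/eqP; case=> /eqP; rewrite oner_eq0. Qed.
HB.instance Definition _ := GRing.Zmodule_isNzRing.Build (quat R)
  quat_mulA quat_mul1l quat_mul1r quat_mulDl quat_mulDr quat_oner_neq0.
End QuatRing.


Section Geometry.
Variable R : realType.

Local Notation H := (quat R).
Local Notation M2 := ('M[quat R]_2).
Local Notation H2 := ('cV[quat R]_2).
Local Notation R8 := ('rV[R]_8).

Definition qreal (c : R) : H := Quat c 0 0 0.
Definition qi : H := Quat 0 1 0 0.
Definition qj : H := Quat 0 0 1 0.
Definition qk : H := Quat 0 0 0 1.
Definition qconj (x : H) : H := Quat (q0 x) (- q1 x) (- q2 x) (- q3 x).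
Definition S3 : set H :=
  [set h | q0 h ^+ 2 + q1 h ^+ 2 + q2 h ^+ 2 + q3 h ^+ 2 = 1].

Definition mx22 (a b c d : H) : M2 :=
  \matrix_(i, j) nth 0 (nth [::] [:: [:: a; b]; [:: c; d]] i) j.
Definition adjmx m n (A : 'M[H]_(m, n)) : 'M[H]_(n, m) := (map_mx qconj A)^T.
Definition Sp2 : set M2 := [set a | adjmx a *m a = 1%:M].

Definition rsqrt2 : R := (Num.sqrt 2)^-1.
Definition frame : seq M2 :=
  [:: mx22 0 0 0 qi; mx22 0 0 0 qj; mx22 0 0 0 qk;
      (qreal rsqrt2) *: mx22 0 qi qi 0;
      (qreal rsqrt2) *: mx22 0 qj qj 0;
      (qreal rsqrt2) *: mx22 0 qk qk 0;
      (qreal rsqrt2) *: mx22 0 1 (- 1) 0].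
Definition e_ (i : 'I_7) : M2 := frame`_i.

(* e^1, ..., e^7 on H^2, which contains T_o S^7 = { X o : X in p } where
   o = (0, 1)^T: the coordinates of X in p are read off X o, the second column
   of X.  The sp(1) block is invisible there, so for X in sp(2) this also gives
   the coordinates of the p-component of X. *)
Definition base_point : H2 := col 1 (1%:M : M2).
Definition coframe (w : H2) (i : 'I_7) : R :=
  [:: q1 (w 1 0); q2 (w 1 0); q3 (w 1 0);
      Num.sqrt 2 * q1 (w 0 0); Num.sqrt 2 * q2 (w 0 0);
      Num.sqrt 2 * q3 (w 0 0); Num.sqrt 2 * q0 (w 0 0)]`_i.

(* [e_i, e_j]_p = sum_k bracket i j k e_k *)
Definition bracket (i j k : 'I_7) : R :=
  coframe ((e_ i *m e_ j - e_ j *m e_ i) *m base_point) k.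

(* g_r (e_i, e_i); the e_i are orthogonal.  g_r is the metric induced by phi r h
   for every h in S^3. *)
Definition g_ (r : R) (i : 'I_7) : R := if (i < 3)%N then r ^+ 2 else r^-1.

(* Tensor fields on S^7 = Sp(2)/Sp(1) are represented by their components in the
   moving frame a |-> (a e_1 o, ..., a e_7 o), i.e. by Ad(Sp(1))-equivariant
   functions of a in Sp(2); the invariant ones are the constant functions.
   In this frame the Levi-Civita connection is
     nabla_i = (derivative along e_i) + Lambda_i,
   Lambda_i e_j = sum_m levi_civita r i j m e_m being given by Koszul's formula
     2 g(Lambda_X Y, Z) = g([X,Y]_p, Z) + g([Z,X]_p, Y) + g(X, [Z,Y]_p). *)
Definition levi_civita (r : R) (i j m : 'I_7) : R :=
  (bracket i j m * g_ r m + bracket m i j * g_ r j + bracket m j i * g_ r i)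
    / (2 * g_ r m).

(* The one-parameter subgroup exp (t e_i) of Sp(2), in closed form because
   e_i^3 = - c^2 e_i with c = 1 for i <= 3 and c = 1 / sqrt 2 otherwise. *)
Definition exp_e (i : 'I_7) (t : R) : M2 :=
  let c := if (i < 3)%N then 1 else rsqrt2 in
  1%:M + qreal (sin (c * t) / c) *: e_ i
       + qreal ((1 - cos (c * t)) / c ^+ 2) *: (e_ i *m e_ i).

Definition frame_deriv (i : 'I_7) (f : M2 -> R) (a : M2) : R :=
  derive1 (fun t : R => f (a *m exp_e i t)) 0.

Definition form1 := 'I_7 -> R.
Definition form2 := 'I_7 -> 'I_7 -> R.
Definition form3 := 'I_7 -> 'I_7 -> 'I_7 -> R.
Definition form4 := 'I_7 -> 'I_7 -> 'I_7 -> 'I_7 -> R.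

Definition wedge11 (a b : form1) : form2 := fun i j => a i * b j - a j * b i.
Definition wedge12 (a : form1) (w : form2) : form3 := fun i j k =>
  a i * w j k + a j * w k i + a k * w i j.

(* The mathematical indices 1, ..., 7 are 0, ..., 6 in 'I_7. *)
Definition dual1 (n : nat) : form1 := fun i => (i.+1 == n :> nat)%:R.
Definition dual2 (m n : nat) : form2 := wedge11 (dual1 m) (dual1 n).

Definition omega_ (l : nat) : form2 := fun i j =>
  [:: dual2 4 7 i j + dual2 5 6 i j;
      dual2 4 6 i j - dual2 5 7 i j;
      dual2 4 5 i j + dual2 6 7 i j]`_l.-1.

Definition Upsilon (h : H) : 'M[R]_3 :=
  let: Quat h0 h1 h2 h3 := h in
  \matrix_(i, l) nth 0 (nth [::] [::
    [:: h0 ^+ 2 + h1 ^+ 2 - h2 ^+ 2 - h3 ^+ 2;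
        2 * (h1 * h2 - h0 * h3); 2 * (h1 * h3 + h0 * h2)];
    [:: 2 * (h1 * h2 + h0 * h3);
        h0 ^+ 2 - h1 ^+ 2 + h2 ^+ 2 - h3 ^+ 2; 2 * (h2 * h3 - h0 * h1)];
    [:: 2 * (h1 * h3 - h0 * h2); 2 * (h2 * h3 + h0 * h1);
        h0 ^+ 2 - h1 ^+ 2 - h2 ^+ 2 + h3 ^+ 2]] i) l.

Definition phi (r : R) (h : H) : M2 -> form3 := fun _ i j k =>
  r ^+ 3 * wedge12 (dual1 1) (dual2 2 3) i j k +
  \sum_(a < 3) \sum_(l < 3)
     Upsilon h a l * wedge12 (dual1 l.+1) (omega_ a.+1) i j k.

(* The sign of the permutation when s is a permutation of 0, ..., 6, and 0 when
   s has a repetition. *)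
Definition epsilon (s : 7.-tuple 'I_7) : R :=
  \prod_(p < 7) \prod_(q < 7 | (p < q)%N)
    Num.sg ((tnth s q : nat)%:R - (tnth s p : nat)%:R).

(* psi = * phi for g_r and vol_{g_r} = r e^{1...7} (r = sqrt (det g_r)), the
   orientation being that of e^{1...7}, which is the one induced by phi r h. *)
Definition star (r : R) (w : form3) : form4 := fun m j k l =>
  6^-1 * \sum_(a < 7) \sum_(b < 7) \sum_(c < 7)
     w a b c / (g_ r a * g_ r b * g_ r c) * (r * epsilon [tuple a; b; c; m; j; k; l]).

Definition nabla3 (r : R) (f : M2 -> form3) (a : M2) (i j k l : 'I_7) : R :=
  frame_deriv i (fun b => f b j k l) a -
  \sum_(m < 7) (levi_civita r i j m * f a m k l +
                levi_civita r i k m * f a j m l +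
                levi_civita r i l m * f a j k m).

(* T i m is T_i^m, the endomorphism with nabla_i phi_{jkl} = T_i^m psi_{mjkl}. *)
Definition torsion (r : R) (f : M2 -> form3) (a : M2) : 'M[R]_7 :=
  xget 0 [set T : 'M[R]_7 | forall i j k l : 'I_7,
    nabla3 r f a i j k l = \sum_(m < 7) T i m * star r (f a) m j k l].

Definition torsion_norm2 (r : R) (f : M2 -> form3) (a : M2) : R :=
  \sum_(i < 7) \sum_(m < 7) torsion r f a i m ^+ 2 * (g_ r m / g_ r i).

Definition div_torsion (r : R) (f : M2 -> form3) (a : M2) (m : 'I_7) : R :=
  \sum_(i < 7) (g_ r i)^-1 *
    (frame_deriv i (fun b => torsion r f b i m) a
     - \sum_(k < 7) levi_civita r i i k * torsion r f a k m
     + \sum_(k < 7) levi_civita r i k m * torsion r f a i k).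

Definition harmonic (r : R) (f : M2 -> form3) : Prop :=
  forall a, Sp2 a -> forall m, div_torsion r f a m = 0.

(* R^8 = H^2 *)
Definition toH2 (x : R8) : H2 :=
  \col_(p < 2) let c n := x 0 (inord (4 * p + n)%N) in
               Quat (c 0%N) (c 1%N) (c 2%N) (c 3%N).
Definition ofH2 (w : H2) : R8 :=
  \row_(n < 8) [:: q0 (w 0 0); q1 (w 0 0); q2 (w 0 0); q3 (w 0 0);
                   q0 (w 1 0); q1 (w 1 0); q2 (w 1 0); q3 (w 1 0)]`_n.

(* `|x| would be the sup norm. *)
Definition norm2 (x : R8) : R := \sum_(n < 8) x 0 n ^+ 2.
Definition S7 : set R8 := [set x | norm2 x = 1].

(* Some a in Sp(2) over x in S^7.  It is only applied to functions invariant
   under a |-> a diag(h, 1), for which the choice is irrelevant. *)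
Definition Sp2_lift (x : R8) : M2 :=
  xget 1%:M [set a | Sp2 a /\ ofH2 (a *m base_point) = x].

Local Notation B := (measurableTypeR R).
Definition leb : {sigma_finite_measure set B -> \bar R} := @lebesgue_measure R.
Definition leb8 : {measure set (B * B * B * B * B * B * B * B) -> \bar R} :=
  (leb \x leb \x leb \x leb \x leb \x leb \x leb \x leb)%E.
Definition R8_of (p : B * B * B * B * B * B * B * B) : R8 :=
  let: (x0, x1, x2, x3, x4, x5, x6, x7) := p in
  \row_(n < 8) [:: x0; x1; x2; x3; x4; x5; x6; x7]`_n.

(* Integral of F over S^7 for the round measure, in polar coordinates:
   int_{|x| <= 1} F (x / |x|) dx = (1 / 8) int_{S^7} F. *)
Definition round_integral (F : R8 -> R) : R :=
  8 * \int[leb8]_(p in [set p | norm2 (R8_of p) <= 1])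
        F ((Num.sqrt (norm2 (R8_of p)))^-1 *: R8_of p).

(* The round metric gives e_1, e_2, e_3 length 1 and e_4, ..., e_7 length
   1 / sqrt 2, so vol_{g_r} = r e^{1...7} is 4 r times the round volume. *)
Definition energy (r : R) (f : M2 -> form3) : R :=
  2^-1 * (4 * r * round_integral (fun x => torsion_norm2 r f (Sp2_lift x))).

Definition partial_deriv (n : 'I_8) (f : R8 -> R) : R8 -> R :=
  fun x => 'D_(delta_mx 0 n) f x.
Definition smooth (f : R8 -> R) : Prop :=
  forall (s : seq 'I_8) (x : R8), differentiable (foldr partial_deriv f s) x.

(* Every smooth vector field on S^7 is the restriction of such a V.  Below, V is
   only evaluated on S^7. *)
Definition vector_field (V : R8 -> R8) : Prop :=
  (forall n, smooth (fun x => V x 0 n)) /\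
  (forall x, S7 x -> \sum_(n < 8) x 0 n * V x 0 n = 0).

(* Since V (a o) = a X o with X in p, X o = a^{-1} V (a o) = a^* V (a o). *)
Definition field_coord (V : R8 -> R8) (a : M2) (i : 'I_7) : R :=
  coframe (adjmx a *m toH2 (V (ofH2 (a *m base_point)))) i.

(* The 3-forms with the same metric and orientation as f are the
     (u^2 - |X|^2) f - 2 u X _| psi + 2 X^b /\ (X _| f),  u^2 + |X|^2 = 1.
   This is the one with (u, X) proportional to (1, - V / 2); as V varies, it
   parametrizes the isometric G2-structures near f, with V _| psi as
   first-order term. *)
Definition isometric_variation (r : R) (f : M2 -> form3) (V : R8 -> R8) :
    M2 -> form3 := fun a i j k =>
  let X := field_coord V a in
  let N := \sum_(m < 7) g_ r m * X m ^+ 2 in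
  ((1 - N / 4) * f a i j k
   + \sum_(m < 7) X m * star r (f a) m i j k
   + 2^-1 * wedge12 (fun p => g_ r p * X p)
                    (fun p q => \sum_(m < 7) X m * f a m p q) i j k)
  / (1 + N / 4).

(* Second variation at f in the above parametrization; at a critical point it
   does not depend on the choice of the parametrization. *)
Definition hessian (r : R) (f : M2 -> form3) (V W : R8 -> R8) : R :=
  derive1 (fun s : R => derive1 (fun t : R =>
    energy r (isometric_variation r f (fun x => s *: V x + t *: W x))) 0) 0.

Definition lincomb n (c : 'I_n -> R) (V : 'I_n -> R8 -> R8) : R8 -> R8 :=
  fun x => \sum_(i < n) c i *: V i x.

Definition neg_def_family (r : R) (f : M2 -> form3) n (V : 'I_n -> R8 -> R8) :=
  [/\ forall i, vector_field (V i),
      forall c, (forall x, S7 x -> lincomb c V x = 0) -> forall i, c i = 0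
    & forall c, (exists i, c i != 0) ->
        hessian r f (lincomb c V) (lincomb c V) < 0].

Definition morse_index (r : R) (f : M2 -> form3) : \bar R :=
  ereal_sup [set n%:R%:E | n in
    [set n | exists V : 'I_n -> R8 -> R8, neg_def_family r f V]].

Definition unstable (r : R) (f : M2 -> form3) : Prop :=
  harmonic r f /\ (0 < morse_index r f)%E.

End Geometry.

Arguments S3 {R}.
Arguments Sp2 {R}.
Arguments S7 {R}.
Arguments rsqrt2 {R}.
Arguments frame {R}.
Arguments e_ {R} i.
Arguments base_point {R}.
Arguments bracket {R} i j k.
Arguments dual1 {R} n.
Arguments dual2 {R} m n.
Arguments omega_ {R} l.

Section SanityChecks.
Variable R : realType.
Local Notation H := (quat R).
Local Notation M2 := ('M[quat R]_2).
Local Notation H2 := ('cV[quat R]_2).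
Local Notation R8 := ('rV[R]_8).
Lemma coframe_e (i j : 'I_7) : coframe (e_ i *m base_point : H2) j = (i == j)%:R.
Proof.
have s2 : Num.sqrt 2 * (rsqrt2 : R) = 1.
  by rewrite mulfV// gt_eqF// sqrtr_gt0 ltr0n.
have -> : (e_ i : M2) *m base_point = col 1 (e_ i) by rewrite /base_point !colE mul1mx.
case: i => [[|[|[|[|[|[|[|//]]]]]]] Hi]; case: j => [[|[|[|[|[|[|[|//]]]]]]] Hj];
rewrite /coframe /e_ /= !mxE /= ?mul0r ?mul1r ?mulr0 ?mulr1 ?subr0 ?addr0 ?s2 //.
all: by rewrite mulr0.
Qed.

Lemma ofH2K : cancel (@ofH2 R) (@toH2 R).
Proof.
move=> w; apply/colP; case=> [[|[|//]]] Hp; rewrite !mxE /= !mxE !inordK //=.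
- by rewrite (_ : Ordinal Hp = 0) //; [case: (w 0 0)|exact: val_inj].
- by rewrite (_ : Ordinal Hp = 1) //; [case: (w 1 0)|exact: val_inj].
Qed.

Lemma bracketC (i j k : 'I_7) : (bracket i j k : R) = - bracket j i k.
Proof.
rewrite /bracket -opprB mulNmx /coframe !mxE /=.
by case: k => [[|[|[|[|[|[|[|//]]]]]]] Hk] /=; rewrite ?mulrN.
Qed.

Lemma g_gt0 (r : R) (i : 'I_7) : 0 < r -> 0 < g_ r i.
Proof. by move=> r0; rewrite /g_; case: ifP; rewrite ?exprn_gt0 ?invr_gt0. Qed.

Lemma levi_civita_torsion_free (r : R) (i j m : 'I_7) : 0 < r ->
  levi_civita r i j m - levi_civita r j i m = bracket i j m.
Proof.
move=> r0; have gm := lt0r_neq0 (g_gt0 m r0).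
by rewrite /levi_civita (bracketC j i m); field.
Qed.

Lemma levi_civita_metric (r : R) (i j m : 'I_7) : 0 < r ->
  levi_civita r i j m * g_ r m + levi_civita r i m j * g_ r j = 0.
Proof.
move=> r0; have gm := lt0r_neq0 (g_gt0 m r0); have gj := lt0r_neq0 (g_gt0 j r0).
rewrite /levi_civita (bracketC i m j) (bracketC j i m) (bracketC j m i).
by field; rewrite gm gj.
Qed.

Lemma field_coordZ (V : R8 -> R8) (a : M2) (t : R) (m : 'I_7) :
  field_coord (fun x => t *: V x) a m = t * field_coord V a m.
Proof.
have qZ (u : R8) : toH2 (t *: u) = qreal t *: toH2 u.
  by apply/matrixP => p q; rewrite !mxE; congr Quat => /=; rewrite ?mxE; ring.
have qC (x : H) : x * qreal t = qreal t * x by congr Quat => /=; ring.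
rewrite /field_coord qZ; set w := toH2 _; set A := adjmx a.
have -> : A *m (qreal t *: w) = qreal t *: (A *m w).
  apply/matrixP => p q; rewrite !mxE mulr_sumr; apply: eq_bigr => l _.
  by rewrite !mxE !mulrA qC.
rewrite /coframe !mxE.
by case: m => [[|[|[|[|[|[|[|//]]]]]]] Hk] /=; ring.
Qed.

Lemma isometric_variation_velocity (r : R) (f : M2 -> form3 R) (V : R8 -> R8)
    (a : M2) (i j k : 'I_7) :
  is_derive (0 : R) 1
    (fun t : R => isometric_variation r f (fun x => t *: V x) a i j k)
    (\sum_(m < 7) field_coord V a m * star r (f a) m i j k).
Proof.
pose N := \sum_(m < 7) g_ r m * field_coord V a m ^+ 2.
pose S := \sum_(m < 7) field_coord V a m * star r (f a) m i j k.
pose W := wedge12 (fun p => g_ r p * field_coord V a p)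
  (fun p q => \sum_(m < 7) field_coord V a m * f a m p q) i j k.

pose num (t : R) := (1 - t ^+ 2 * (N / 4)) * f a i j k + t * S + t ^+ 2 * (2^-1 * W).
pose den (t : R) := 1 + t ^+ 2 * (N / 4).
have -> : (fun t : R => isometric_variation r f (fun x => t *: V x) a i j k)
  = (fun t => num t * (den t)^-1).
  apply/funext => t.
  have NE : \sum_(m < 7) g_ r m * field_coord (fun x => t *: V x) a m ^+ 2
      = t ^+ 2 * N.
    by rewrite mulr_sumr; apply: eq_bigr => m _; rewrite field_coordZ; ring.
  have SE p q : \sum_(m < 7) field_coord (fun x => t *: V x) a m * f a m p q
      = t * \sum_(m < 7) field_coord V a m * f a m p q.
    by rewrite mulr_sumr; apply: eq_bigr => m _; rewrite field_coordZ; ring.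
  rewrite /isometric_variation NE; congr (_ * _^-1); last by rewrite /den mulrA.
  congr (_ + _ + _); first by rewrite mulrA.
    by rewrite mulr_sumr; apply: eq_bigr => m _; rewrite field_coordZ; ring.
  by rewrite /W /wedge12 !SE !field_coordZ; ring.
have dnum : is_derive (0 : R) (1 : R) num S.
  apply: is_derive_eq; rewrite /GRing.scale /=; ring.
have dden : is_derive (0 : R) (1 : R) den 0.
  apply: is_derive_eq; rewrite /GRing.scale /=; ring.
have den0 : den 0 = 1 by rewrite /den expr0n mul0r addr0.
have dV : is_derive (0 : R) (1 : R) (fun t => (den t)^-1) 0.
  apply: is_derive_eq; first by apply: is_deriveV; rewrite den0 oner_eq0.
  by rewrite scaler0.
apply: is_derive_eq.
by rewrite den0 scaler0 add0r invr1 scale1r.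
Qed.
End SanityChecks.

(* Main.v *)
(** Invariant vector fields suffice: the infinitesimal right translations
    x |-> x y (y an imaginary quaternion) of S^7 in H^2 span the invariant
    directions, and moving phi_(r,h) along them stays in the homogeneous class,
    the point h moving to h (1 + r y), normalized.  On that class the torsion is
    explicit and
      |T|^2 = 19 r^-2 - 14 r + 4 r^4 + 8 h_2^2 (r^4 + r - 2 r^-2),
    where r^4 + r - 2 r^-2 = r^-2 (r^3 - 1) (r^3 + 2) has the sign of r - 1.
    Hence E is a function of h_2^2 alone: for r < 1 it is maximal at h_2 = 0 in the
    direction in which h_2 varies, and for r > 1 it is maximal at h = (0,0,1,0) or
    (0,0,-1,0) in all three invariant directions. *)

Require Import Defs.
From Stdlib Require Import ZArith Ring_polynom Ring_theory InitialRing.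
From mathcomp Require Import all_boot all_order all_algebra.
From mathcomp Require Import all_classical all_reals all_analysis.
From mathcomp Require Import measurable_realfun.
From mathcomp Require Import ring lra.
From mathcomp Require Import ssrZ.
Import Order.TTheory GRing.Theory Num.Theory.
Import numFieldNormedType.Exports.
Set Implicit Arguments.
Unset Strict Implicit.
Unset Printing Implicit Defensive.

(** * Tensor calculus on polynomial expressions *)

Delimit Scope Z_scope with ZZ.

Definition pexpr := PExpr Z.

Definition pnorm (rel : seq (pexpr * pexpr)) (e : pexpr) : Pol Z :=
  norm_subst 0%ZZ 1%ZZ Z.add Z.mul Z.sub Z.opp Z.eqb Z.quotrem 10
    (mk_monpol_list 0%ZZ 1%ZZ Z.add Z.mul Z.sub Z.opp Z.eqb Z.quotrem rel) e.

(* Equality modulo the rewriting of monomials x into e for (x, e) in rel. *)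
Definition peq rel (e1 e2 : pexpr) : bool :=
  Ring_polynom.Peq Z.eqb (pnorm rel e1) (pnorm rel e2).

Definition pc (z : Z) : pexpr := PEc z.
Definition px (i : positive) : pexpr := PEX Z i.
Definition padd (a b : pexpr) :=
  match a, b with
  | PEc x, PEc y => PEc (x + y)%ZZ
  | PEc Z0, _ => b
  | _, PEc Z0 => a
  | _, _ => PEadd a b
  end.
Definition pmul (a b : pexpr) :=
  match a, b with
  | PEc x, PEc y => PEc (x * y)%ZZ
  | PEc Z0, _ | _, PEc Z0 => PEc 0%ZZ
  | _, _ => PEmul a b
  end.
Definition popp (a : pexpr) := if a is PEc x then PEc (- x)%ZZ else PEopp a.
Definition psub a b := padd a (popp b).
Definition psum n (f : nat -> pexpr) :=
  foldr (fun i => padd (f i)) (pc 0) (iota 0 n).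
Definition pbool (b : bool) := if b then pc 1 else pc 0.
Arguments padd : simpl never.
Arguments pmul : simpl never.
Arguments popp : simpl never.
Arguments psub : simpl never.

Declare Scope pe_scope.
Delimit Scope pe_scope with PE.
Local Open Scope pe_scope.
Notation "a + b" := (padd a b) : pe_scope.
Notation "a - b" := (psub a b) : pe_scope.
Notation "a * b" := (pmul a b) : pe_scope.

(* The variables stand for r, 1/r, h_0, ..., h_3, y_1, y_2, y_3 and sqrt 2; the
   definitions below are the images of those of Defs.v in these polynomials. *)
Definition pr := px 1.
Definition prV := px 2.
Definition ph : quat pexpr := Quat (px 3) (px 4) (px 5) (px 6).
Definition py (i : nat) := nth (pc 0) [:: px 7; px 8; px 9] i.
Definition psqrt2 := px 10.

Definition rels : seq (pexpr * pexpr) :=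
  [:: (PEmul pr prV, pc 1);
      (PEmul psqrt2 psqrt2, pc 2);
      (PEmul (q0 ph) (q0 ph),
        pc 1 - q1 ph * q1 ph - q2 ph * q2 ph - q3 ph * q3 ph)].

Definition pqmul (x y : quat pexpr) : quat pexpr :=
  Quat (q0 x * q0 y - q1 x * q1 y - q2 x * q2 y - q3 x * q3 y)
       (q0 x * q1 y + q1 x * q0 y + q2 x * q3 y - q3 x * q2 y)
       (q0 x * q2 y - q1 x * q3 y + q2 x * q0 y + q3 x * q1 y)
       (q0 x * q3 y + q1 x * q2 y - q2 x * q1 y + q3 x * q0 y).
Definition pqadd (x y : quat pexpr) : quat pexpr :=
  Quat (q0 x + q0 y) (q1 x + q1 y) (q2 x + q2 y) (q3 x + q3 y).
Definition pqopp (x : quat pexpr) : quat pexpr :=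
  Quat (popp (q0 x)) (popp (q1 x)) (popp (q2 x)) (popp (q3 x)).
Definition pqunit n (c : pexpr) : quat pexpr :=
  let z := pc 0 in
  nth (Quat c z z z)
    [:: Quat c z z z; Quat z c z z; Quat z z c z; Quat z z z c] n.

(* Entry (p, q) of 2 e_i, which has no denominator. *)
Definition pframe (i p q : nat) : quat pexpr :=
  if (i < 3)%N then pqunit i.+1 (if (p == 1)%N && (q == 1)%N then pc 2 else pc 0)
  else if (i < 6)%N then pqunit i.-2 (if p == q then pc 0 else psqrt2)
  else pqunit 0 (if p == q then pc 0 else if p == 0%N then psqrt2 else popp psqrt2).
Definition pprod i j p :=
  pqadd (pqmul (pframe i p 0) (pframe j 0 1)) (pqmul (pframe i p 1) (pframe j 1 1)).
Definition pcomm i j p := pqadd (pprod i j p) (pqopp (pprod j i p)).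
Definition pcoframe (u v : quat pexpr) k :=
  nth (pc 0) [:: q1 v; q2 v; q3 v; psqrt2 * q1 u; psqrt2 * q2 u; psqrt2 * q3 u;
                 psqrt2 * q0 u] k.

Definition pw11 (a b : nat -> pexpr) i j := a i * b j - a j * b i.
Definition pw12 (a : nat -> pexpr) (w : nat -> nat -> pexpr) i j k :=
  a i * w j k + a j * w k i + a k * w i j.
Definition pw22 (v w : nat -> nat -> pexpr) i j k l :=
  v i j * w k l - v i k * w j l + v i l * w j k
  + v j k * w i l - v j l * w i k + v k l * w i j.
Definition pd1 n i := pbool (i.+1 == n)%N.
Definition pd2 m n := pw11 (pd1 m) (pd1 n).
Definition pom l i j :=
  nth (pc 0) [:: pd2 4 7 i j + pd2 5 6 i j; pd2 4 6 i j - pd2 5 7 i j;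
                 pd2 4 5 i j + pd2 6 7 i j] l.-1.
Definition pvol3 := pw12 (pd1 1) (pd2 2 3).
Definition pUpsilon (x : quat pexpr) a l : pexpr :=
  let: Quat h0 h1 h2 h3 := x in
  nth (pc 0) (nth [::] [::
    [:: h0 * h0 + h1 * h1 - h2 * h2 - h3 * h3;
        pc 2 * (h1 * h2 - h0 * h3); pc 2 * (h1 * h3 + h0 * h2)];
    [:: pc 2 * (h1 * h2 + h0 * h3);
        h0 * h0 - h1 * h1 + h2 * h2 - h3 * h3; pc 2 * (h2 * h3 - h0 * h1)];
    [:: pc 2 * (h1 * h3 - h0 * h2); pc 2 * (h2 * h3 + h0 * h1);
        h0 * h0 - h1 * h1 - h2 * h2 + h3 * h3]] a) l.
Definition pphi (x : quat pexpr) i j k :=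
  pr * pr * pr * pvol3 i j k +
  psum 3 (fun a => psum 3 (fun l =>
    pUpsilon x a l * pw12 (pd1 l.+1) (pom a.+1) i j k)).

(* psi = r^-2 e^{4567} + r sum_{a,l} Upsilon_{al} ( *_3 e^l ) /\ omega_a, with *_3 the
   Hodge star of e^1, e^2, e^3. *)
Definition pstar3 l := nth (pd2 2 3) [:: pd2 2 3; pd2 3 1; pd2 1 2] l.
Definition ppsi m j k l :=
  prV * prV * pw22 (pd2 4 5) (pd2 6 7) m j k l +
  psum 3 (fun a => psum 3 (fun b =>
    pr * pUpsilon ph a b * pw22 (pstar3 b) (pom a.+1) m j k l)).

Definition pg i := if (i < 3)%N then pr * pr else prV.
Definition pgV i := if (i < 3)%N then prV * prV else pr.

(* The structure constants are those of the 3-form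
   2 e^{123} + e^1 /\ omega_1 - e^2 /\ omega_2 + e^3 /\ omega_3. *)
Definition pbracket i j k :=
  pc 2 * pvol3 i j k + pw12 (pd1 1) (pom 1) i j k
  - pw12 (pd1 2) (pom 2) i j k + pw12 (pd1 3) (pom 3) i j k.
Definition plevi_civita2 i j m :=
  (pbracket i j m * pg m + pbracket m i j * pg j + pbracket m j i * pg i) * pgV m.

(* Tabulated once, which makes the verifications below fast. *)
Definition tab3 (f : nat -> nat -> nat -> pexpr) :=
  mkseq (fun i => mkseq (fun j => mkseq (f i j) 7) 7) 7.
Definition get3 t i j k : pexpr := nth (pc 0) (nth [::] (nth [::] t i) j) k.
Definition phi_table := Eval vm_compute in tab3 (pphi ph).
Definition tphi := get3 phi_table.
Definition levi_civita_table := Eval vm_compute in tab3 plevi_civita2.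
Definition tlc2 := get3 levi_civita_table.
Definition psi_table :=
  Eval vm_compute in mkseq (fun m => tab3 (ppsi m)) 7.
Definition tpsi m := get3 (nth [::] psi_table m).

Definition sgZ (x y : nat) : Z :=
  if (x < y)%N then 1%ZZ else if (y < x)%N then (-1)%ZZ else 0%ZZ.
Fixpoint eps (s : seq nat) : Z :=
  if s is x :: s' then foldr (fun y => Z.mul (sgZ x y)) (eps s') s' else 1%ZZ.

(* 6 ( * phi); the tests on repeated indices only avoid useless computations. *)
Definition pstar6 m j k l :=
  if ~~ uniq [:: m; j; k; l] then pc 0 else
  psum 7 (fun a => if ~~ uniq [:: a; m; j; k; l] then pc 0 else
  psum 7 (fun b => if ~~ uniq [:: b; a; m; j; k; l] then pc 0 else
  psum 7 (fun c => if ~~ uniq [:: c; b; a; m; j; k; l] then pc 0 else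
     tphi a b c * (pgV a * pgV b * pgV c *
       (pr * pc (eps [:: a; b; c; m; j; k; l])))))).

Definition pnabla2 i j k l :=
  popp (psum 7 (fun m => tlc2 i j m * tphi m k l + tlc2 i k m * tphi j m l
                         + tlc2 i l m * tphi j k m)).

(* 2 T_i^m, found by contracting nabla_i phi with psi: 24 T_i^m is
   nabla_i phi_{jkl} psi^{mjkl}. *)
Definition ptorsion2 i m : pexpr :=
  let: Quat h0 h1 h2 h3 := ph in
  let u := pc 8 * prV - pc 4 * pr * pr in
  let v := pc 4 * pr * pr in
  let d := v * h2 * h2 - pr * pr in
  let z := pc 0 in
  nth z (nth [::] [::
    [:: pc 2 * pr * pr - pc 6 * prV + u * (h2 * h2 + h3 * h3);
        u * (h0 * h3 - h1 * h2); popp (u * (h1 * h3 + h0 * h2)); z; z; z; z];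
    [:: u * (h0 * h3 + h1 * h2);
        pc 2 * prV - pc 2 * pr * pr - u * (h1 * h1 + h3 * h3);
        u * (h2 * h3 - h0 * h1); z; z; z; z];
    [:: u * (h0 * h2 - h1 * h3); popp (u * (h2 * h3 + h0 * h1));
        pc 2 * pr * pr - pc 6 * prV + u * (h1 * h1 + h2 * h2); z; z; z; z];
    [:: z; z; z; d; v * h1 * h2; v * h0 * h2; popp (v * h2 * h3)];
    [:: z; z; z; popp (v * h1 * h2); d; popp (v * h2 * h3); popp (v * h0 * h2)];
    [:: z; z; z; popp (v * h0 * h2); v * h2 * h3; d; v * h1 * h2];
    [:: z; z; z; v * h2 * h3; v * h0 * h2; popp (v * h1 * h2); d]] i) m.

(* For X = 2 (y_1 e_1 + y_2 e_2 + y_3 e_3), the numerator of the isometric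
   variation of phi, and what it should be: X moves h to h (1 + r y). *)
Definition pmoved : quat pexpr :=
  pqmul ph (Quat (pc 1) (pr * py 0) (pr * py 1) (pr * py 2)).
Definition psqnorm := pr * pr * (py 0 * py 0 + py 1 * py 1 + py 2 * py 2).
Definition pvariation_num i j k :=
  (pc 1 - psqnorm) * tphi i j k + psum 7 (fun m => pc 2 * py m * tpsi m i j k)
  + pw12 (fun p => pg p * py p)
         (fun p q => psum 7 (fun m => pc 2 * py m * tphi m p q)) i j k.
Definition pvariation_phi i j k :=
  pphi pmoved i j k + psqnorm * pr * pr * pr * pvol3 i j k.

Definition all7 (p : nat -> bool) := all p (iota 0 7).
Definition all7_2 (p : nat -> nat -> bool) := all7 (fun i => all7 (p i)).
Definition all7_3 (p : nat -> nat -> nat -> bool) := all7 (fun i => all7_2 (p i)).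
Definition all7_4 (p : nat -> nat -> nat -> nat -> bool) :=
  all7 (fun i => all7_3 (p i)).

Lemma all7P p : all7 p -> forall i : 'I_7, p i.
Proof. by move=> /allP H i; apply: H; rewrite mem_iota /=. Qed.

Lemma all7_2P p : all7_2 p -> forall i j : 'I_7, p i j.
Proof. by move=> /all7P H i; apply: all7P; exact: H. Qed.

Lemma all7_3P p : all7_3 p -> forall i j k : 'I_7, p i j k.
Proof. by move=> /all7P H i; apply: all7_2P; exact: H. Qed.

Lemma all7_4P p : all7_4 p -> forall i j k l : 'I_7, p i j k l.
Proof. by move=> /all7P H i; apply: all7_3P; exact: H. Qed.

Lemma get3_tab3 f (i j k : 'I_7) : get3 (tab3 f) i j k = f i j k.
Proof. by rewrite /get3 /tab3 !nth_mkseq. Qed.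

Lemma tphiE (i j k : 'I_7) : tphi i j k = pphi ph i j k.
Proof.
have E : phi_table = tab3 (pphi ph) by vm_compute.
by rewrite /tphi E get3_tab3.
Qed.

Lemma tlc2E (i j m : 'I_7) : tlc2 i j m = plevi_civita2 i j m.
Proof.
have E : levi_civita_table = tab3 plevi_civita2 by vm_compute.
by rewrite /tlc2 E get3_tab3.
Qed.

Lemma bracket_identity : all7_3 (fun i j k =>
  peq rels (pcoframe (pcomm i j 0) (pcomm i j 1) k) (pc 4 * pbracket i j k)).
Proof. by vm_compute. Qed.

Lemma star_identity : all7_4 (fun m j k l =>
  peq rels (pstar6 m j k l) (pc 6 * tpsi m j k l)).
Proof. by vm_compute. Qed.

Lemma nabla_identity : all7_4 (fun i j k l =>
  peq rels (pnabla2 i j k l) (psum 7 (fun m => ptorsion2 i m * tpsi m j k l))).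
Proof. by vm_compute. Qed.

Lemma psi_identity : all7_2 (fun m n =>
  peq rels
    (psum 7 (fun j => psum 7 (fun k => psum 7 (fun l =>
      tpsi m j k l * tpsi n j k l * (pgV j * pgV k * pgV l)))))
    (pbool (m == n)%N * (pc 24 * pg m))).
Proof. by vm_compute. Qed.

Lemma norm_identity :
  peq rels
    (psum 7 (fun i => psum 7 (fun m =>
      ptorsion2 i m * ptorsion2 i m * (pg m * pgV i))))
    (pc 76 * prV * prV - pc 56 * pr + pc 16 * pr * pr * pr * pr
     + pc 32 * q2 ph * q2 ph * (pr * pr * pr * pr + pr - pc 2 * prV * prV)).
Proof. by vm_compute. Qed.

Lemma div_identity : all7 (fun m =>
  peq rels
    (psum 7 (fun i => pgV i *
      (psum 7 (fun k => tlc2 i k m * ptorsion2 i k)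
       - psum 7 (fun k => tlc2 i i k * ptorsion2 k m))))
    (pc 16 * q2 ph * (pc 2 * prV * prV * prV - pc 1 - pr * pr * pr) *
     nth (pc 0) [:: q3 ph; q0 ph; popp (q1 ph)] m)).
Proof. by vm_compute. Qed.

Lemma variation_identity : all7_3 (fun i j k =>
  peq rels (pvariation_num i j k) (pvariation_phi i j k)).
Proof. by vm_compute. Qed.

Local Close Scope pe_scope.
Local Open Scope classical_set_scope.
Local Open Scope ring_scope.

(** * Evaluation of polynomial expressions *)

Section PolynomialReflection.
Variable R : comNzRingType.

Definition Zr (z : Z) : R := (int_of_Z z)%:~R.

Definition peval (l : seq R) (e : pexpr) : R :=
  PEeval 0 1 +%R *%R (fun x y => x - y) -%R Zr id_phi_N (pow_N 1 *%R) l e.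

Lemma Zr_morph : ring_morph 0 1 +%R *%R (fun x y => x - y) -%R eq
  0%ZZ 1%ZZ Z.add Z.mul Z.sub Z.opp Z.eqb Zr.
Proof.
split=> //; rewrite /Zr.
- by move=> x y; rewrite -[Z.add x y]/(x + y) !rmorphD.
- by move=> x y; rewrite -[Z.sub x y]/(x - y) !rmorphB.
- by move=> x y; rewrite -[Z.mul x y]/(x * y) !rmorphM.
- by move=> x; rewrite -[Z.opp x]/(- x) !rmorphN.
- by move=> x y /Z.eqb_eq ->.
Qed.

Lemma peqP l rel e1 e2 :
  (forall p, List.In p rel -> peval l p.1 = peval l p.2) ->
  peq rel e1 e2 -> peval l e1 = peval l e2.
Proof.
move=> relP; apply: (ring_correct (Eqsth R) (Eq_ext _ _ _) _ Zr_morph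
  (pow_N_th 1 *%R (Eqsth R)) (Ztriv_div_th (Eqsth R) Zr)).
  apply: (Rth_ARth (Eqsth R) (Eq_ext _ _ _)).
  split=> //; [exact: add0r|exact: addrC|exact: addrA|exact: mul1r|exact: mulrC
    |exact: mulrA|exact: mulrDl|exact: subrr].
elim: rel relP => //= p [|q rel] IH relP.
  by case: p relP => a b relP; apply: (relP (a, b)); left.
case: p relP => a b relP; split; first by apply: (relP (a, b)); left.
by apply: IH => x xrel; apply: relP; right.
Qed.

Variable l : seq R.
Local Notation ev := (peval l).

Lemma peval_padd a b : ev (padd a b) = ev a + ev b.
Proof.
have zr : forall p, ev (PEc p) = Zr p by [].
case: a b => [||[|p|p]|p|a1 a2|a1 a2|a1 a2|a1|a1 n] [||[|q|q]|q|b1 b2|b1 b2|b1 b2|b1|b1 m] //;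
 rewrite /padd ?(zr (Z0)) ?(morph0 Zr_morph) ?addr0 ?add0r // !zr.
all: exact: morph_add Zr_morph _ _.
Qed.

Lemma peval_pmul a b : ev (pmul a b) = ev a * ev b.
Proof.
have zr : forall p, ev (PEc p) = Zr p by [].
case: a b => [||[|p|p]|p|a1 a2|a1 a2|a1 a2|a1|a1 n] [||[|q|q]|q|b1 b2|b1 b2|b1 b2|b1|b1 m] //;
 rewrite /pmul ?(zr (Z0)) ?(morph0 Zr_morph) ?mulr0 ?mul0r // !zr.
all: exact: morph_mul Zr_morph _ _.
Qed.

Lemma peval_popp a : ev (popp a) = - ev a.
Proof. by case: a => // p; exact: morph_opp Zr_morph _. Qed.

Lemma peval_psub a b : ev (psub a b) = ev a - ev b.
Proof. by rewrite /psub peval_padd peval_popp. Qed.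

Lemma peval_pc n : ev (pc (Z.of_nat n)) = n%:R.
Proof. by rewrite /peval /= /Zr /int_of_Z; case: n => [|n] //=; rewrite SuccNat2Pos.id_succ. Qed.

Lemma peval_pbool b : ev (pbool b) = b%:R.
Proof. by case: b; [apply: (peval_pc 1)|apply: (peval_pc 0)]. Qed.

Lemma peval_psum n f : ev (psum n f) = \sum_(i < n) ev (f i).
Proof.
rewrite -(big_mkord xpredT (fun i => ev (f i))) /index_iota subn0 /psum.
elim: (iota 0 n) => [|i s IH]; first by rewrite big_nil; apply: (peval_pc 0).
by rewrite big_cons /= peval_padd IH.
Qed.

End PolynomialReflection.

Lemma qrealM (R : realType) c (x : quat R) :
  qreal c * x = Quat (c * q0 x) (c * q1 x) (c * q2 x) (c * q3 x).
Proof. by congr Quat => /=; ring. Qed.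

Lemma double_rsqrt2 (R : realType) : 2 * rsqrt2 = Num.sqrt 2 :> R.
Proof.
rewrite /rsqrt2 -[X in X / _](@sqr_sqrtr R 2) ?ler0n // expr2 mulfK //.
Qed.

Section DefinitionsAsPolynomials.
Variable R : realType.
Variables (r : R) (h : quat R) (y1 y2 y3 : R).

Definition env : seq R :=
  [:: r; r^-1; q0 h; q1 h; q2 h; q3 h; y1; y2; y3; Num.sqrt 2].
Local Notation ev := (peval env).

Definition qeval (x : quat pexpr) : quat R :=
  Quat (ev (q0 x)) (ev (q1 x)) (ev (q2 x)) (ev (q3 x)).

Definition pevalE :=
  (peval_padd, peval_pmul, peval_popp, peval_psub, peval_psum, peval_pbool).

Let evn n : ev (pc (Z.of_nat n)) = n%:R.
Proof. exact: peval_pc. Qed.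

Let evsqrt2 : ev psqrt2 = Num.sqrt 2.
Proof. by []. Qed.

Lemma qeval_ph : qeval ph = h.
Proof. by rewrite /qeval /peval /=; case: (h). Qed.

Lemma qevalM x z : qeval (pqmul x z) = qeval x * qeval z.
Proof. by rewrite /qeval /= !pevalE. Qed.

Lemma qevalD x z : qeval (pqadd x z) = qeval x + qeval z.
Proof. by rewrite /qeval /= !pevalE. Qed.

Lemma qevalN x : qeval (pqopp x) = - qeval x.
Proof. by rewrite /qeval /= !pevalE. Qed.

Lemma peval_nth s n : ev (nth (pc 0) s n) = nth 0 (map ev s) n.
Proof. by elim: s n => [|e s IH] [|n] //=; exact: (evn 0). Qed.

Lemma qeval_pframe (i : 'I_7) (p q : 'I_2) :
  qeval (pframe i p q) = qreal 2 * e_ i p q.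
Proof.
have ev0 : ev (pc 0) = 0 := evn 0; have ev2 : ev (pc 2) = 2 := evn 2.
have evt : ev psqrt2 = 2 * rsqrt2 by rewrite double_rsqrt2.
case: i => [[|[|[|[|[|[|[|//]]]]]]] Hi]; case: p => [[|[|//]] ?];
  case: q => [[|[|//]] ?];
  rewrite /e_ /frame /= !mxE /= /qeval /= ?pevalE ?evt ?ev0 ?ev2;
  congr Quat => /=; rewrite -?double_rsqrt2; ring.
Qed.

Lemma qeval_pprod (i j : 'I_7) (p : 'I_2) :
  qeval (pprod i j p) = qreal 4 * (e_ i *m e_ j) p 1.
Proof.
have q4 (a b : quat R) : (qreal 2 * a) * (qreal 2 * b) = qreal 4 * (a * b).
  by congr Quat => /=; ring.
have l1 : lift ord0 ord0 = 1 :> 'I_2 by exact: val_inj.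
rewrite /pprod qevalD !qevalM !mxE big_ord_recl big_ord1 l1.
rewrite (qeval_pframe i p 0) (qeval_pframe j 0 1).
rewrite (qeval_pframe i p 1) (qeval_pframe j 1 1).
by rewrite (q4 (e_ i p 0)) (q4 (e_ i p 1)) mulrDr.
Qed.

Lemma qeval_pcomm (i j : 'I_7) (p : 'I_2) :
  qeval (pcomm i j p) =
  qreal 4 * ((e_ i *m e_ j - e_ j *m e_ i) *m base_point) p 0.
Proof.
rewrite qevalD qevalN !qeval_pprod -mulrBr.
by rewrite /base_point !colE mul1mx -colE !mxE.
Qed.

Lemma peval_pcoframe u v (w : 'cV[quat R]_2) (k : 'I_7) :
  qeval u = qreal 4 * w 0 0 -> qeval v = qreal 4 * w 1 0 ->
  ev (pcoframe u v k) = 4 * coframe w k.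
Proof.
rewrite !qrealM => E0 E1.
have a0 : ev (q0 u) = _ := congr1 (@q0 R) E0.
have a1 : ev (q1 u) = _ := congr1 (@q1 R) E0.
have a2 : ev (q2 u) = _ := congr1 (@q2 R) E0.
have a3 : ev (q3 u) = _ := congr1 (@q3 R) E0.
have b1 : ev (q1 v) = _ := congr1 (@q1 R) E1.
have b2 : ev (q2 v) = _ := congr1 (@q2 R) E1.
have b3 : ev (q3 v) = _ := congr1 (@q3 R) E1.
rewrite /pcoframe peval_nth [map _ _]/= !peval_pmul evsqrt2 a0 a1 a2 a3 b1 b2 b3.
rewrite /coframe; move: (w 0 0) (w 1 0) => v0 v1.
by case: k => [[|[|[|[|[|[|[|//]]]]]]] ?] /=; ring.
Qed.

Lemma peval_pw11 (a b : nat -> pexpr) (a' b' : form1 R) :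
  (forall i : 'I_7, ev (a i) = a' i) -> (forall i : 'I_7, ev (b i) = b' i) ->
  forall i j : 'I_7, ev (pw11 a b i j) = wedge11 a' b' i j.
Proof. by move=> Ha Hb i j; rewrite !pevalE !Ha !Hb. Qed.

Lemma peval_pw12 (a : nat -> pexpr) (b : nat -> nat -> pexpr)
    (a' : form1 R) (b' : form2 R) :
  (forall i : 'I_7, ev (a i) = a' i) ->
  (forall i j : 'I_7, ev (b i j) = b' i j) ->
  forall i j k : 'I_7, ev (pw12 a b i j k) = wedge12 a' b' i j k.
Proof. by move=> Ha Hb i j k; rewrite !pevalE !Ha !Hb. Qed.

Lemma peval_pd1 n (i : 'I_7) : ev (pd1 n i) = dual1 n i.
Proof. exact: peval_pbool. Qed.

Lemma peval_pd2 m n (i j : 'I_7) : ev (pd2 m n i j) = dual2 m n i j.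
Proof. by apply: peval_pw11 => k; exact: peval_pd1. Qed.

Lemma peval_pom n (i j : 'I_7) : ev (pom n i j) = omega_ n i j.
Proof. by rewrite /pom /omega_ peval_nth /= !(peval_pd2, pevalE). Qed.

Lemma peval_pvol3 (i j k : 'I_7) :
  ev (pvol3 i j k) = wedge12 (dual1 1) (dual2 2 3) i j k.
Proof. exact: (peval_pw12 (peval_pd1 1) (peval_pd2 2 3)). Qed.

Lemma peval_pUpsilon x (a l : 'I_3) :
  ev (pUpsilon x a l) = Upsilon (qeval x) a l.
Proof.
have ev2 : ev (pc 2) = 2 := evn 2.
case: x => x0 x1 x2 x3; rewrite /Upsilon mxE.
by case: a => [[|[|[|//]]] ?]; case: l => [[|[|[|//]]] ?] /=;
  rewrite !pevalE ?ev2 ?expr2.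
Qed.

Lemma peval_pphi x b (i j k : 'I_7) : ev (pphi x i j k) = phi r (qeval x) b i j k.
Proof.
rewrite /pphi /phi peval_padd peval_psum !peval_pmul peval_pvol3 exprS expr2 !mulrA.
congr (_ + _); apply: eq_bigr => a _; rewrite peval_psum; apply: eq_bigr => l _.
by rewrite peval_pmul peval_pUpsilon (peval_pw12 (peval_pd1 l.+1) (peval_pom a.+1)).
Qed.

Lemma peval_tphi b (i j k : 'I_7) : ev (tphi i j k) = phi r h b i j k.
Proof. by rewrite tphiE (peval_pphi _ b) qeval_ph. Qed.

Lemma peval_pg (i : 'I_7) : ev (pg i) = g_ r i.
Proof. by rewrite /pg /g_; case: ifP => _ //; rewrite peval_pmul expr2. Qed.

Lemma peval_pgV (i : 'I_7) : ev (pgV i) = (g_ r i)^-1.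
Proof.
by rewrite /pgV /g_; case: ifP => _; rewrite ?invrK // peval_pmul expr2 invfM.
Qed.

Hypothesis r0 : r != 0.
Hypothesis hS : S3 h.

Lemma peval_rels p : List.In p rels -> ev p.1 = ev p.2.
Proof.
have e1 : ev (pc 1) = 1 := evn 1.
case=> [<-|[<-|[<-|//]]].
- by change (r * r^-1 = ev (pc 1)); rewrite e1 mulfV.
- change (Num.sqrt 2 * Num.sqrt 2 = ev (pc 2)).
  by rewrite (evn 2) -expr2 sqr_sqrtr.
- change (q0 h * q0 h = ev (pc 1 - q1 ph * q1 ph - q2 ph * q2 ph - q3 ph * q3 ph)%PE).
  rewrite !peval_psub !peval_pmul e1 -[X in _ = X - _ - _ - _]hS.
  change (q0 h * q0 h = q0 h ^+ 2 + q1 h ^+ 2 + q2 h ^+ 2 + q3 h ^+ 2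
    - q1 h * q1 h - q2 h * q2 h - q3 h * q3 h).
  ring.
Qed.

Lemma peq_peval e1 e2 : peq rels e1 e2 -> ev e1 = ev e2.
Proof. exact: peqP peval_rels. Qed.

Lemma peval_pbracket (i j k : 'I_7) : ev (pbracket i j k) = bracket i j k.
Proof.
have := peq_peval (all7_3P bracket_identity i j k).
rewrite (peval_pcoframe k (qeval_pcomm i j 0) (qeval_pcomm i j 1)).
rewrite (peval_pmul _ (pc 4)) (evn 4) => /mulfI E.
by rewrite /bracket E // pnatr_eq0.
Qed.

Lemma g_neq0 (i : 'I_7) : g_ r i != 0.
Proof. by rewrite /g_; case: ifP => _; rewrite ?expf_neq0 ?invr_eq0. Qed.

Lemma peval_tlc2 (i j m : 'I_7) : ev (tlc2 i j m) = 2 * levi_civita r i j m.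
Proof.
rewrite tlc2E /plevi_civita2 peval_pmul !peval_padd (peval_pmul _ (pbracket i j m)).
rewrite (peval_pmul _ (pbracket m i j)) (peval_pmul _ (pbracket m j i)).
rewrite !peval_pbracket !peval_pg peval_pgV /levi_civita.
by have := g_neq0 m; move: (g_ r m) => g g0; field.
Qed.

Lemma Zr_sgZ (x y : nat) : Zr R (sgZ x y) = Num.sg (y%:R - x%:R).
Proof.
rewrite /sgZ; case: (ltngtP x y) => xy.
- by rewrite gtr0_sg ?subr_gt0 ?ltr_nat //; exact: (morph1 (Zr_morph R)).
- by rewrite ltr0_sg ?subr_lt0 ?ltr_nat.
- by rewrite xy subrr sgr0; exact: (morph0 (Zr_morph R)).
Qed.

Lemma Zr_eps n (s : n.-tuple nat) : Zr R (eps s) =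
  \prod_(p < n) \prod_(q < n | (p < q)%N) Num.sg ((tnth s q)%:R - (tnth s p)%:R).
Proof.
elim: n s => [|n IH] s; first by rewrite tuple0 big_ord0; exact: (morph1 (Zr_morph R)).
case/tupleP: s => x s; rewrite big_ord_recl big_mkcond big_ord_recl /= mul1r.
have -> : Zr R (foldr (fun y => Z.mul (sgZ x y)) (eps s) s) =
   (\prod_(i < n) Num.sg ((tnth s i)%:R - x%:R)) * Zr R (eps s).
  rewrite -(big_tuple _ _ s xpredT (fun y => Num.sg (y%:R - x%:R))).
  elim: (val s) (eps s) => [|y t IHt] z /=; first by rewrite big_nil mul1r.
  by rewrite (morph_mul (Zr_morph R)) IHt big_cons Zr_sgZ mulrA.
rewrite IH; congr (_ * _); first by apply: eq_bigr => i _; rewrite tnth0 tnthS.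
apply: eq_bigr => p _; rewrite [RHS]big_mkcond big_ord_recl /= mul1r -big_mkcond /=.
by apply: eq_big => [q|q _]; rewrite ?tnthS // /bump !add1n ltnS.
Qed.

Lemma epsilonE (a b c m j k l : 'I_7) : epsilon R [tuple a; b; c; m; j; k; l] =
  Zr R (eps [:: val a; val b; val c; val m; val j; val k; val l]).
Proof.
rewrite (Zr_eps [tuple val a; val b; val c; val m; val j; val k; val l]) /epsilon.
apply: eq_bigr => p _; apply: eq_bigr => q _.
by rewrite !(tnth_nth 0%N) !(tnth_nth a); congr (Num.sg (_%:R - _%:R));
  [move: (q) => {p q}p| ]; case: p => [[|[|[|[|[|[|[|//]]]]]]] ?].
Qed.

Lemma eps_nuniq s : ~~ uniq s -> eps s = 0%ZZ.
Proof.
elim: s => //= x s IH; rewrite negb_and negbK => /orP[xs|/IH ->]; last first.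
  by elim: s {IH} => //= y s ->; rewrite Z.mul_0_r.
elim: s xs {IH} (eps s) => //= y s IH; rewrite inE => /orP[/eqP <-|/IH xs] z.
  by rewrite /sgZ ltnn.
by rewrite xs Z.mul_0_r.
Qed.

Lemma peval_pstar6 a (m j k l : 'I_7) :
  ev (pstar6 m j k l) = 6 * star r (phi r h a) m j k l.
Proof.
rewrite /star mulrA mulfV ?pnatr_eq0 // mul1r.
have eps0 (s : seq nat) (x : R) e : (~~ uniq s -> x = 0) -> (uniq s -> ev e = x) ->
    ev (if ~~ uniq s then pc 0 else e) = x.
  by case: ifP => [us H _|/negbFE us _ H]; rewrite ?H //; exact: (evn 0).
have term (b1 b2 b3 : 'I_7) :
    ~~ uniq [:: val b3; val b2; val b1; val m; val j; val k; val l] ->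
    phi r h a b1 b2 b3 / (g_ r b1 * g_ r b2 * g_ r b3)
      * (r * epsilon R [tuple b1; b2; b3; m; j; k; l]) = 0.
  move=> nu; rewrite epsilonE eps_nuniq ?(morph0 (Zr_morph R)) ?mulr0 //.
  apply: contra nu; rewrite (perm_uniq (_ : perm_eq _
    [:: val b3; val b2; val b1; val m; val j; val k; val l])) //.
  by apply/permP => P /=; rewrite addnCA [(P (val b1) + _)%N]addnCA addnCA.
rewrite /pstar6; apply: (eps0) => [nu|_].
  rewrite big1 // => b1 _; rewrite big1 // => b2 _; rewrite big1 // => b3 _.
  by apply: (term); apply: contra nu => /and4P[].
rewrite peval_psum; apply: eq_bigr => b1 _; apply: (eps0) => [nu|_].
  rewrite big1 // => b2 _; rewrite big1 // => b3 _.
  by apply: (term); apply: contra nu => /and3P[].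
rewrite peval_psum; apply: eq_bigr => b2 _; apply: (eps0) => [nu|_].
  rewrite big1 // => b3 _.
  by apply: (term); apply: contra nu => /andP[].
rewrite peval_psum; apply: eq_bigr => b3 _; apply: (eps0) => [nu|_]; first exact: (term).
by rewrite !peval_pmul (peval_tphi a) !peval_pgV epsilonE !invfM !mulrA.
Qed.

Lemma star_phi a (m j k l : 'I_7) : star r (phi r h a) m j k l = ev (tpsi m j k l).
Proof.
have := peq_peval (all7_4P star_identity m j k l).
by rewrite (peval_pstar6 a) (peval_pmul _ (pc 6)) (evn 6) => /mulfI ->.
Qed.

Lemma star_phi_nondegenerate b (v : 'I_7 -> R) :
  (forall j k l, \sum_(m < 7) v m * star r (phi r h b) m j k l = 0) ->
  forall m, v m = 0.
Proof.
move=> H n.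
have E m : \sum_(j < 7) \sum_(k < 7) \sum_(l < 7) star r (phi r h b) m j k l *
    (star r (phi r h b) n j k l * (g_ r j * g_ r k * g_ r l)^-1) =
    (m == n)%:R * (24 * g_ r m).
  have := peq_peval (all7_2P psi_identity m n).
  rewrite (peval_pmul _ (pbool _)) peval_pbool (peval_pmul _ (pc 24)) (evn 24).
  rewrite peval_pg => <-.
  rewrite peval_psum; apply: eq_bigr => j _; rewrite peval_psum.
  apply: eq_bigr => k _; rewrite peval_psum; apply: eq_bigr => l _.
  by rewrite !peval_pmul !peval_pgV !star_phi !invfM !mulrA.
have : \sum_(m < 7) v m * ((m == n)%:R * (24 * g_ r m)) = 0.
  under eq_bigr => m _ do rewrite -E mulr_sumr.
  rewrite exchange_big big1 // => j _.
  under eq_bigr => m _ do rewrite mulr_sumr.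
  rewrite exchange_big big1 // => k _.
  under eq_bigr => m _ do rewrite mulr_sumr.
  rewrite exchange_big big1 // => l _.
  under eq_bigr => m _ do rewrite mulrA.
  by rewrite -mulr_suml H mul0r.
rewrite (bigD1 n) //= eqxx mul1r big1 ?addr0 => [|m /negbTE ->]; last first.
  by rewrite mul0r mulr0.
move/eqP; rewrite mulf_eq0 mulf_eq0 (negbTE (g_neq0 n)) pnatr_eq0 /= orbF.
by move/eqP.
Qed.

Definition torsion_mx : 'M[R]_7 := \matrix_(i, m) (2^-1 * ev (ptorsion2 i m)).

Section Torsion.
Variables (f : 'M[quat R]_2 -> form3 R) (a : 'M[quat R]_2).
Hypothesis fa : f a = phi r h a.
Hypothesis df : forall i j k l : 'I_7, frame_deriv i (fun b => f b j k l) a = 0.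

Lemma nabla_phi (i j k l : 'I_7) :
  nabla3 r f a i j k l = \sum_(m < 7) torsion_mx i m * star r (f a) m j k l.
Proof.
have two : (2 : R) != 0 by rewrite pnatr_eq0.
apply: (mulfI two); rewrite mulr_sumr fa.
under eq_bigr => m _ do rewrite star_phi mxE mulrA mulVKf // -peval_pmul.
rewrite -(peval_psum _ 7 (fun m => pmul (ptorsion2 i m) (tpsi m j k l))).
rewrite -(peq_peval (all7_4P nabla_identity i j k l)).
rewrite /nabla3 df sub0r /pnabla2 peval_popp peval_psum mulrN mulr_sumr fa.
congr (- _); apply: eq_bigr => m _.
rewrite !peval_padd !peval_pmul !peval_tlc2 !(peval_tphi a).
move: (levi_civita r i j m) (levi_civita r i k m) (levi_civita r i l m) => A B C.
by move: (phi r h a m k l) (phi r h a j m l) (phi r h a j k m) => F G H; ring.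
Qed.

Lemma torsion_phi : torsion r f a = torsion_mx.
Proof.
apply: xget_unique => [i j k l|T HT]; first exact: nabla_phi.
apply/matrixP => i n; apply/eqP; rewrite -subr_eq0; apply/eqP.
apply: (@star_phi_nondegenerate a (fun n => T i n - torsion_mx i n)) => j k l.
under eq_bigr => m _ do rewrite mulrBl.
by rewrite sumrB -fa -HT nabla_phi subrr.
Qed.

Lemma torsion_norm2_phi : torsion_norm2 r f a =
  19 * r ^- 2 - 14 * r + 4 * r ^+ 4 + 8 * (r ^+ 4 + r - 2 * r ^- 2) * q2 h ^+ 2.
Proof.
have four : (4 : R) != 0 by rewrite pnatr_eq0.
rewrite /torsion_norm2 torsion_phi; apply: (mulfI four).
transitivity (ev (psum 7 (fun i => psum 7 (fun m =>
    ptorsion2 i m * ptorsion2 i m * (pg m * pgV i))))%PE).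
  rewrite peval_psum mulr_sumr; apply: eq_bigr => i _.
  rewrite peval_psum mulr_sumr; apply: eq_bigr => m _.
  by rewrite !peval_pmul peval_pg peval_pgV !mxE; field; exact: g_neq0.
rewrite (peq_peval norm_identity) !(peval_padd, peval_psub, peval_pmul).
rewrite (evn 76) (evn 56) (evn 16) (evn 32) (evn 2).
by rewrite -[ev pr]/r -[ev prV]/r^-1 -[ev (q2 ph)]/(q2 h); field.
Qed.

Lemma peval_pvariation_phi b (i j k : 'I_7) : ev (pvariation_phi i j k) =
  phi r (h * Quat 1 (r * y1) (r * y2) (r * y3)) b i j k
  + ev psqnorm * r ^+ 3 * wedge12 (dual1 1) (dual2 2 3) i j k.
Proof.
rewrite peval_padd (peval_pphi _ b) (peval_pmul _ _ (pvol3 i j k)) peval_pvol3.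
rewrite !(peval_pmul _ _ pr) -[ev pr]/r qevalM qeval_ph.
have -> : qeval (Quat (pc 1) (pr * py 0) (pr * py 1) (pr * py 2))%PE =
    Quat 1 (r * y1) (r * y2) (r * y3).
  by congr Quat.
by congr (_ + _ * _); rewrite !exprS expr0 mulr1 !mulrA.
Qed.

Lemma phi_scale c x b i j k : phi r (qreal c * x) b i j k =
  r ^+ 3 * wedge12 (dual1 1) (dual2 2 3) i j k +
  c ^+ 2 * (phi r x b i j k - r ^+ 3 * wedge12 (dual1 1) (dual2 2 3) i j k).
Proof.
have US u v : Upsilon (qreal c * x) u v = c ^+ 2 * Upsilon x u v.
  rewrite qrealM; case: x => x0 x1 x2 x3 /=; rewrite !mxE.
  by case: u => [[|[|[|//]]] ?]; case: v => [[|[|[|//]]] ?] /=; ring.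
rewrite [X in _ + _ * X]addrC [X in _ + _ * X]addKr [LHS]/phi; congr (_ + _).
rewrite mulr_sumr; apply: eq_bigr => u _; rewrite mulr_sumr; apply: eq_bigr => v _.
by rewrite US mulrA.
Qed.

Definition sqnorm : R := r ^+ 2 * (y1 ^+ 2 + y2 ^+ 2 + y3 ^+ 2).
Definition moved : quat R :=
  qreal (Num.sqrt (1 + sqnorm))^-1 * (h * Quat 1 (r * y1) (r * y2) (r * y3)).

Lemma sqnorm_ge0 : 0 <= sqnorm.
Proof. by rewrite mulr_ge0 ?sqr_ge0 // !addr_ge0 ?sqr_ge0. Qed.

Let sqnorm1_neq0 : 1 + sqnorm != 0.
Proof. by rewrite gt_eqF // ltr_pwDl // sqnorm_ge0. Qed.

Lemma q2_moved_sqr :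
  q2 moved ^+ 2 = (q2 h + r * q2 (h * Quat 0 y1 y2 y3)) ^+ 2 / (1 + sqnorm).
Proof.
rewrite /moved qrealM /= exprMn exprVn sqr_sqrtr ?addr_ge0 ?sqnorm_ge0 // mulrC.
by congr (_ ^+ 2 / _); ring.
Qed.

Lemma S3_moved : S3 moved.
Proof.
rewrite /S3 /moved qrealM /= !exprMn exprVn sqr_sqrtr ?addr_ge0 ?sqnorm_ge0 //.
apply: (mulfI sqnorm1_neq0); rewrite -!mulrDr mulVKf //.
transitivity ((q0 h ^+ 2 + q1 h ^+ 2 + q2 h ^+ 2 + q3 h ^+ 2) * (1 + sqnorm)).
  by rewrite /sqnorm; ring.
by rewrite [X in X * _](hS : _ = 1) mulrC.
Qed.

Lemma variation_phi V b i j k :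
  (forall m : 'I_7, field_coord V a m = 2 * [:: y1; y2; y3]`_m) ->
  isometric_variation r f V a i j k = phi r moved b i j k.
Proof.
move=> X.
have evy (m : 'I_7) : ev (pc 2 * py m)%PE = field_coord V a m.
  by rewrite X peval_pmul (evn 2) peval_nth.
have evy' (m : 'I_7) : ev (py m) = 2^-1 * field_coord V a m.
  by rewrite X peval_nth mulKf ?pnatr_eq0.
have N4 : (\sum_(m < 7) g_ r m * field_coord V a m ^+ 2) / 4 = sqnorm.
  rewrite !big_ord_recl big_ord0 !X /= /bump /=.
  by rewrite /g_ /= /sqnorm; field.
have evN : ev psqnorm = sqnorm.
  by rewrite /psqnorm !(peval_padd, peval_pmul) /sqnorm !expr2.
have E : ev (pvariation_num i j k) = ev (pvariation_phi i j k) :=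
  peq_peval (all7_3P variation_identity i j k).
have wX : ev (pw12 (fun p => pg p * py p)
    (fun p q => psum 7 (fun m => pc 2 * py m * tphi m p q)) i j k)%PE
  = wedge12 (fun p => 2^-1 * (g_ r p * field_coord V a p))
   (fun p q => \sum_(m < 7) field_coord V a m * f a m p q) i j k.
  apply: peval_pw12 => [p|p q]; first by rewrite peval_pmul peval_pg evy'; ring.
  rewrite peval_psum; apply: eq_bigr => m _.
  by rewrite peval_pmul evy fa (peval_tphi a).
have wZ (u : form1 R) (v : form2 R) :
    wedge12 (fun p => 2^-1 * u p) v i j k = 2^-1 * wedge12 u v i j k.
  by rewrite /wedge12; ring.
move: E; rewrite peval_padd wX peval_padd (peval_pmul _ (psub _ _)) peval_psub.
rewrite (evn 1) evN (peval_tphi a) peval_psum.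
under eq_bigr => m _ do rewrite peval_pmul evy -(star_phi a).
rewrite (peval_pvariation_phi b) evN wZ fa => E.
rewrite /isometric_variation N4 phi_scale exprVn sqr_sqrtr ?addr_ge0 ?sqnorm_ge0 //.
apply: (mulIf sqnorm1_neq0); rewrite mulfVK // fa E.
move: (phi r _ b i j k) (wedge12 _ _ i j k) => A B; field; exact: sqnorm1_neq0.
Qed.

End Torsion.

Lemma div_torsion_mx m : q2 h = 0 \/ [/\ q0 h = 0, q1 h = 0 & q3 h = 0] ->
  \sum_(i < 7) (g_ r i)^-1 *
    (- \sum_(k < 7) levi_civita r i i k * torsion_mx k m
     + \sum_(k < 7) levi_civita r i k m * torsion_mx i k) = 0.
Proof.
move=> Hh.
transitivity (4^-1 * ev (psum 7 (fun i => pgV i *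
  (psum 7 (fun k => tlc2 i k m * ptorsion2 i k)
   - psum 7 (fun k => tlc2 i i k * ptorsion2 k m))))%PE).
  rewrite peval_psum mulr_sumr; apply: eq_bigr => i _.
  rewrite (peval_pmul _ (pgV i)) peval_pgV peval_psub !peval_psum.
  have lcT (u v w p q : 'I_7) : ev (tlc2 u v w * ptorsion2 p q)%PE =
      4 * (levi_civita r u v w * torsion_mx p q).
    rewrite peval_pmul peval_tlc2 mxE.
    by move: (levi_civita r u v w) => A; field.
  under [in RHS]eq_bigr => k _ do rewrite lcT.
  rewrite -mulr_sumr; under [X in _ - X]eq_bigr => k _ do rewrite lcT.
  rewrite -mulr_sumr -mulrBr.
  by move: (\sum_(k < 7) _) (\sum_(k < 7) _) (g_ r i)^-1 => A B C; field.
rewrite (peq_peval (all7P div_identity m)) 3!peval_pmul -[ev (q2 ph)]/(q2 h) peval_nth.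
case: Hh => [->|[h0 h1 h3]]; first by rewrite !(mul0r, mulr0).
have -> : map ev [:: q3 ph; q0 ph; popp (q1 ph)] = [:: q3 h; q0 h; - q1 h] by [].
rewrite h0 h1 h3 oppr0; case: m => [[|[|[|m]]]] Hm; rewrite /= ?nth_nil ?mulr0 //.
Qed.

End DefinitionsAsPolynomials.

(** * Sp(2) and its one-parameter subgroups *)

Section Sp2Theory.
Variable R : realType.
Local Notation H := (quat R).
Local Notation M2 := ('M[H]_2).

Lemma quat_eq (x z : H) : q0 x = q0 z -> q1 x = q1 z -> q2 x = q2 z -> q3 x = q3 z -> x = z.
Proof. by case: x z => ? ? ? ? [? ? ? ?] /= -> -> -> ->. Qed.

Lemma qconjD (x z : H) : qconj (x + z) = qconj x + qconj z.
Proof. by apply: quat_eq => /=; rewrite ?opprD. Qed.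

Lemma qconjM (x z : H) : qconj (x * z) = qconj z * qconj x.
Proof. by apply: quat_eq => /=; ring. Qed.

Lemma qconj_sum I (s : seq I) (F : I -> H) :
  qconj (\sum_(i <- s) F i) = \sum_(i <- s) qconj (F i).
Proof.
have qconj0 : qconj 0 = 0 :> H by apply: quat_eq => /=; rewrite ?oppr0.
exact: (big_morph _ qconjD qconj0).
Qed.

Lemma qreal_comm c (x : H) : x * qreal c = qreal c * x.
Proof. by apply: quat_eq => /=; ring. Qed.

Lemma qreal_mul c d : qreal (c * d) = qreal c * qreal d :> H.
Proof. by apply: quat_eq => /=; ring. Qed.

Lemma qreal0 : qreal 0 = 0 :> H. Proof. by []. Qed.

Lemma adjmxD m n (A B : 'M[H]_(m, n)) : adjmx (A + B) = adjmx A + adjmx B.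
Proof. by apply/matrixP => i j; rewrite !mxE qconjD. Qed.

Lemma adjmxZ m n c (A : 'M[H]_(m, n)) : adjmx (qreal c *: A) = qreal c *: adjmx A.
Proof.
apply/matrixP => i j; rewrite !mxE qconjM -qreal_comm; congr (_ * _).
by apply: quat_eq => /=; rewrite ?oppr0.
Qed.

Lemma adjmxM m n p (A : 'M[H]_(m, n)) (B : 'M[H]_(n, p)) :
  adjmx (A *m B) = adjmx B *m adjmx A.
Proof.
apply/matrixP => i j; rewrite !mxE qconj_sum; apply: eq_bigr => k _.
by rewrite !mxE qconjM.
Qed.

Lemma adjmx1 n : adjmx (1%:M : 'M[H]_n) = 1%:M.
Proof.
apply/matrixP => i j; rewrite !mxE eq_sym.
by case: (i == j); apply: quat_eq => /=; rewrite ?oppr0.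
Qed.

Lemma mul_qscalemx m n p c (A : 'M[H]_(m, n)) (B : 'M[H]_(n, p)) :
  A *m (qreal c *: B) = qreal c *: (A *m B).
Proof.
apply/matrixP => i j; rewrite !mxE mulr_sumr; apply: eq_bigr => k _.
by rewrite !mxE !mulrA qreal_comm.
Qed.

Definition frame_speed (i : 'I_7) : R := if (i < 3)%N then 1 else rsqrt2.

Lemma rsqrt2_sqr : rsqrt2 ^+ 2 = 2^-1 :> R.
Proof. by rewrite /rsqrt2 exprVn sqr_sqrtr. Qed.

Lemma frame_speed_neq0 i : frame_speed i != 0.
Proof.
rewrite /frame_speed; case: ifP => _; first exact: oner_neq0.
by rewrite -sqrf_eq0 rsqrt2_sqr invr_eq0 pnatr_eq0.
Qed.

Lemma adjmx_e (i : 'I_7) : adjmx (e_ i) = qreal (-1) *: e_ i :> M2.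
Proof.
apply/matrixP => p q; rewrite !mxE.
case: i => [[|[|[|[|[|[|[|//]]]]]]] Hi]; case: p => [[|[|//]] ?]; case: q => [[|[|//]] ?];
 rewrite /e_ /= !mxE /=; apply: quat_eq => /=; ring.
Qed.

Lemma e_sqr (i : 'I_7) : e_ i *m e_ i =
  qreal (- frame_speed i ^+ 2) *: (if (i < 3)%N then mx22 0 0 0 1 else 1%:M) :> M2.
Proof.
rewrite /frame_speed; apply/matrixP => p q; rewrite !mxE big_ord_recl big_ord1.
case: i => [[|[|[|[|[|[|[|//]]]]]]] Hi]; case: p => [[|[|//]] ?]; case: q => [[|[|//]] ?];
 rewrite /e_ /= !mxE /= ?rsqrt2_sqr -?rsqrt2_sqr; apply: quat_eq => /=; ring.
Qed.

Lemma e_cube (i : 'I_7) :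
  e_ i *m (e_ i *m e_ i) = qreal (- frame_speed i ^+ 2) *: e_ i :> M2.
Proof.
rewrite e_sqr mul_qscalemx; congr (_ *: _); case: ifP => i3; last by rewrite mulmx1.
apply/matrixP => p q; rewrite !mxE big_ord_recl big_ord1.
case: i i3 => [[|[|[|//]]] Hi] _; case: p => [[|[|//]] ?]; case: q => [[|[|//]] ?];
 rewrite /e_ /= !mxE /=; apply: quat_eq => /=; ring.
Qed.

Lemma mul_exp_cubic (e : M2) (k S D : R) :
  e *m (e *m e) = qreal k *: e -> D + D - S * S + k * (D * D) = 0 ->
  (1%:M + qreal (- S) *: e + qreal D *: (e *m e)) *m
  (1%:M + qreal S *: e + qreal D *: (e *m e)) = 1%:M.
Proof.
move=> eP SD.
have Pe : (e *m e) *m e = qreal k *: e by rewrite -mulmxA.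
have PP : (e *m e) *m (e *m e) = qreal k *: (e *m e) by rewrite -{1}mulmxA eP mul_qscalemx.
rewrite mulmxDr mulmxDr mulmx1 !mul_qscalemx !mulmxDl !mul1mx -!scalemxAl eP Pe PP.
move: (e *m e) => P; apply/matrixP => p q; rewrite !mxE.
move: (e p q) (P p q) (_ *+ _) => x z w.
rewrite -[RHS]addr0 -[X in _ = w + X](mul0r z) -qreal0 -SD.
by apply: quat_eq => /=; ring.
Qed.

Lemma adjmx_e_combo (i : 'I_7) (S D : R) :
  adjmx (1%:M + qreal S *: e_ i + qreal D *: (e_ i *m e_ i)) =
  1%:M + qreal (- S) *: e_ i + qreal D *: (e_ i *m e_ i) :> M2.
Proof.
rewrite !adjmxD !adjmxZ adjmx1 adjmxM adjmx_e -scalemxAl mul_qscalemx.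
by rewrite !scalerA -!qreal_mul ?(mulrN1, opprK).
Qed.

Lemma adjmx_mul_exp_e i t : adjmx (exp_e i t) *m exp_e i t = 1%:M :> M2.
Proof.
rewrite /exp_e -/(frame_speed i); set c := frame_speed i.
set S := sin _ / c; set D := _ / c ^+ 2.
rewrite adjmx_e_combo.
apply: (mul_exp_cubic (e_cube i)); rewrite -/c /S /D.
have := cos2Dsin2 (c * t); have := frame_speed_neq0 i; rewrite -/c => c0 E.
transitivity (- (cos (c * t) ^+ 2 + sin (c * t) ^+ 2 - 1) / c ^+ 2).
  by field.
by rewrite E subrr oppr0 mul0r.
Qed.

Lemma Sp2_mul_exp_e (a : M2) i t : Sp2 a -> Sp2 (a *m exp_e i t).
Proof.
move=> aS; rewrite /Sp2 /= adjmxM mulmxA -(mulmxA _ (adjmx a)) aS mulmx1.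
exact: adjmx_mul_exp_e.
Qed.

Lemma Sp2_1 : Sp2 (1%:M : M2).
Proof. by rewrite /Sp2 /= adjmx1 mulmx1. Qed.

Lemma Sp2_Sp2_lift (x : 'rV[R]_8) : Sp2 (Sp2_lift x).
Proof.
rewrite /Sp2_lift; case: (pselect (exists a : M2, Sp2 a /\ ofH2 (a *m base_point) = x)) => [|nex].
  by move/(xgetPex 1%:M) => [].
rewrite xgetPN; first exact: Sp2_1.
by move=> a aP; apply: nex; exists a.
Qed.

Lemma frame_deriv_eq0 i (F : M2 -> R) a v : Sp2 a ->
  (forall b, Sp2 b -> F b = v) -> frame_deriv i F a = 0.
Proof.
move=> aS Fv; rewrite /frame_deriv.
have -> : (fun t : R => F (a *m exp_e i t)) = cst v.
  by apply/funext => t; apply/Fv/Sp2_mul_exp_e.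
exact: derive1_cst.
Qed.

Definition right_mul (x : H) (v : 'rV[R]_8) : 'rV[R]_8 := ofH2 (toH2 v *m x%:M).

Lemma field_coord_right_mul x a (m : 'I_7) : Sp2 a ->
  field_coord (right_mul x) a m = [:: q1 x; q2 x; q3 x]`_m.
Proof.
move=> aS; rewrite /field_coord /right_mul !ofH2K !mulmxA aS mul1mx.
have E p : ((base_point : 'cV[H]_2) *m x%:M) p 0 = (p == 1)%:R * x.
  by rewrite !mxE big_ord1 /base_point !mxE.
rewrite /coframe !E /= mul0r mul1r.
by case: m => [[|[|[|[|[|[|[|//]]]]]]] ?] /=; ring.
Qed.
End Sp2Theory.

(** * Right translations as vector fields *)

Section Fields.
Variable R : realType.
Local Notation R8 := ('rV[R]_8).
Local Notation H := (quat R).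

Definition affine (c : 'I_8 -> R) (d : R) (x : R8) : R := \sum_(m < 8) c m * x 0 m + d.

Lemma differentiable_affine c d x : differentiable (affine c d) x.
Proof.
have -> : affine c d = (\sum_(m < 8) (c m *: (fun x : R8 => x 0 m))) + cst d.
  by apply/funext => z; rewrite /affine fct_sumE.
apply: differentiableD => //; apply: differentiable_sum => m.
by apply: differentiableZ; exact: differentiable_coord.
Qed.

Lemma partial_deriv_affine n c d : partial_deriv n (affine c d) = affine (fun=> 0) (c n).
Proof.
apply/funext => x; rewrite /partial_deriv /derive [RHS]/affine.
rewrite big1 ?add0r => [|m _]; last by rewrite mul0r.
apply: cvg_lim => //.
apply: cvg_near_cst; near=> t.
have t0 : t != 0 by near: t; exact: nbhs_dnbhs_neq.
rewrite /affine /shift /= opprD addrACA subrr addr0 -sumrB.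
rewrite (bigD1 n) //= big1 => [|m mn]; last first.
  by rewrite !mxE /= (negbTE mn) mulr0 add0r subrr.
by rewrite !mxE /= eqxx mulr1 addr0 mulrDr addrK /GRing.scale /= mulrC mulfK.
Unshelve. all: by end_near. Qed.

Lemma smooth_affine c d : smooth (affine c d).
Proof.
move=> s x; suff [c' [d' ->]] : exists c' d',
    foldr (@partial_deriv R) (affine c d) s = affine c' d'.
  exact: differentiable_affine.
elim: s => [|n s [c' [d' IH]]] /=; first by exists c, d.
by exists (fun=> 0), (c' n); rewrite IH partial_deriv_affine.
Qed.

Lemma right_mulE (x : H) (v : R8) :
  let q p := Quat (v 0 (inord (4 * p + 0))) (v 0 (inord (4 * p + 1)))
                  (v 0 (inord (4 * p + 2))) (v 0 (inord (4 * p + 3))) * x in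
  right_mul x v = \row_(n < 8) [:: q0 (q 0%N); q1 (q 0%N); q2 (q 0%N); q3 (q 0%N);
                   q0 (q 1%N); q1 (q 1%N); q2 (q 1%N); q3 (q 1%N)]`_n.
Proof.
move=> q; apply/rowP => n; rewrite /right_mul /ofH2 mxE [RHS]mxE.
have E (p : 'I_2) : (toH2 v *m x%:M) p 0 = q p.
  by rewrite !mxE big_ord1 !mxE mulr1n.
by rewrite !E.
Qed.

Lemma right_mul_linear (x : H) (c : R) (u v : R8) :
  right_mul x (c *: u + v) = c *: right_mul x u + right_mul x v.
Proof.
rewrite !right_mulE; apply/rowP => n; rewrite !mxE.
by case: n => [[|[|[|[|[|[|[|[|//]]]]]]]] ?] /=; ring.
Qed.

Lemma smooth_right_mul (x : H) n : smooth (fun v : R8 => right_mul x v 0 n).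
Proof.
have r0 : right_mul x 0 = 0.
  by have := right_mul_linear x (-1) 0 0; rewrite scaler0 addr0 scaleN1r addNr.
have -> : (fun v : R8 => right_mul x v 0 n) =
    affine (fun m => right_mul x (delta_mx 0 m) 0 n) 0; last exact: smooth_affine.
apply/funext => v; rewrite {1}[v]row_sum_delta /affine addr0.
rewrite (_ : right_mul x _ = \sum_(m < 8) v 0 m *: right_mul x (delta_mx 0 m)).
  by rewrite summxE; apply: eq_bigr => m _; rewrite mxE mulrC.
apply: (big_rec2 (fun a b => right_mul x a = b)) => // m a b _ <-.
exact: right_mul_linear.
Qed.

Lemma right_mulD (x z : H) v : right_mul (x + z) v = right_mul x v + right_mul z v.
Proof.
rewrite !right_mulE; apply/rowP => n; rewrite !mxE.
by case: n => [[|[|[|[|[|[|[|[|//]]]]]]]] ?] /=; ring.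
Qed.

Lemma right_mulZ c (x : H) v : right_mul (qreal c * x) v = c *: right_mul x v.
Proof.
rewrite !right_mulE; apply/rowP => n; rewrite !mxE.
by case: n => [[|[|[|[|[|[|[|[|//]]]]]]]] ?] /=; ring.
Qed.

Lemma lincomb_right_mul n (c : 'I_n -> R) (x : 'I_n -> H) :
  lincomb c (fun i => right_mul (x i)) = right_mul (\sum_(i < n) qreal (c i) * x i).
Proof.
apply/funext => v; rewrite /lincomb.
apply: (big_rec2 (fun a b => a = right_mul b v)) => [|i a b _ ->].
  by have := right_mulZ 0 0 v; rewrite mulr0 scale0r.
by rewrite right_mulD right_mulZ.
Qed.

Lemma vector_field_right_mul (x : H) : q0 x = 0 -> vector_field (right_mul x).
Proof.
move=> x0; split=> [n|v _]; first exact: smooth_right_mul.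
rewrite right_mulE; under eq_bigr => n _ do rewrite mxE -[n in v 0 n]inord_val.
by rewrite !big_ord_recl big_ord0 /= /bump /= x0; ring.
Qed.

Lemma right_mul_eq0 (x : H) : (forall v, S7 v -> right_mul x v = 0) -> x = 0.
Proof.
move=> H; have /H E : S7 (delta_mx 0 0 : R8).
  rewrite /S7 /= /norm2 (bigD1 0) //= big1 ?addr0 => [|n n0].
    by rewrite mxE eqxx expr1n.
  by rewrite mxE (negbTE n0) andbF expr0n.
have e0 : inord 0 = 0 :> 'I_8 by apply: val_inj; rewrite /= inordK.
have en (n : nat) : (0 < n < 8)%N -> inord n == 0 :> 'I_8 = false.
  by case/andP=> n0 n8; apply/negbTE; rewrite -val_eqE /= inordK // -lt0n.
have Ex (k : 'I_8) := congr1 (fun w : R8 => w 0 k) E.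
apply: quat_eq.
- have := Ex 0; rewrite right_mulE !mxE /= e0 !en // ?eqxx /=.
  by rewrite !(mul1r, mul0r, subr0, addr0, add0r).
- have := Ex (inord 1); rewrite right_mulE !mxE /= inordK //= e0 !en // ?eqxx /=.
  by rewrite !(mul1r, mul0r, subr0, addr0, add0r).
- have := Ex (inord 2); rewrite right_mulE !mxE /= inordK //= e0 !en // ?eqxx /=.
  by rewrite !(mul1r, mul0r, subr0, addr0, add0r).
- have := Ex (inord 3); rewrite right_mulE !mxE /= inordK //= e0 !en // ?eqxx /=.
  by rewrite !(mul1r, mul0r, subr0, addr0, add0r).
Qed.
End Fields.

(** * Volume of the ball *)

Section EightfoldProduct.
Context (R : realType) (d : measure_display) (T : measurableType d).
Local Notation T8 := (T * T * T * T * T * T * T * T)%type.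

Definition sum8 (f : T -> R) (p : T8) : R :=
  f p.1.1.1.1.1.1.1 + f p.1.1.1.1.1.1.2 + f p.1.1.1.1.1.2 + f p.1.1.1.1.2
  + f p.1.1.1.2 + f p.1.1.2 + f p.1.2 + f p.2.

Lemma measurable_sum8 f : measurable_fun setT f -> measurable_fun setT (sum8 f).
Proof.
move=> mf.
have step d' (T' : measurableType d') (g : T' -> R) : measurable_fun setT g ->
    measurable_fun setT (fun p : T' * T => g p.1 + f p.2).
  move=> mg; apply: measurable_funD; first exact: measurableT_comp mg measurable_fst.
  exact: measurableT_comp mf measurable_snd.
have m1 := step _ _ _ mf; have m2 := step _ _ _ m1; have m3 := step _ _ _ m2.
have m4 := step _ _ _ m3; have m5 := step _ _ _ m4; have m6 := step _ _ _ m5.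
exact: step _ _ _ m6.
Qed.

Definition cube8 (A : set T) : set T8 := A `*` A `*` A `*` A `*` A `*` A `*` A `*` A.

Lemma measurable_cube8 A : measurable A -> measurable (cube8 A).
Proof. by move=> mA; rewrite /cube8; repeat (apply: measurableX => //). Qed.

Lemma product_measure_cube8 (mu : {sigma_finite_measure set T -> \bar R}) A v :
  measurable A -> mu A = v%:E ->
  (mu \x mu \x mu \x mu \x mu \x mu \x mu \x mu)%E (cube8 A) = (v ^+ 8)%:E.
Proof.
move=> mA muA.
have step d' (T' : measurableType d') (nu : {measure set T' -> \bar R}) (C : set T') w :
    measurable C /\ nu C = w%:E ->
    measurable (C `*` A) /\ (nu \x mu)%E (C `*` A) = (w * v)%:E.
  move=> [mC Cw]; split; first exact: measurableX.
  by rewrite product_measure1E // Cw EFinM; congr (_ * _)%E.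
have s2 := step _ _ _ _ _ (conj mA muA); have s3 := step _ _ _ _ _ s2.
have s4 := step _ _ _ _ _ s3; have s5 := step _ _ _ _ _ s4.
have s6 := step _ _ _ _ _ s5; have s7 := step _ _ _ _ _ s6.
have [_ s8] := step _ _ _ _ _ s7.
by rewrite /cube8 s8 !exprS expr0 mulr1 !mulrA.
Qed.
End EightfoldProduct.

Section Ball.
Variable R : realType.
Local Notation B := (measurableTypeR R).
Local Notation B8 := (B * B * B * B * B * B * B * B)%type.

Definition ball8 : set B8 := [set p | norm2 (R8_of p) <= 1].
Local Notation sqr := (fun x : B => x ^+ 2 : R).

Lemma ball8E : ball8 = [set p | sum8 sqr p <= 1].
Proof.
apply/seteqP; split => -[[[[[[[x0 x1] x2] x3] x4] x5] x6] x7];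
  by rewrite /ball8 /sum8 /= /norm2 !big_ord_recl big_ord0 /R8_of !mxE /= addr0 !addrA.
Qed.

Lemma measurable_ball8 : measurable ball8.
Proof.
have m0 : measurable_fun setT sqr by exact: measurable_funX.
have := measurable_sum8 m0 measurableT (measurable_itv (`]-oo, 1] : interval R)).
by rewrite setTI ball8E; congr (measurable _).
Qed.

Local Notation centered c := (`[- c, c]%classic : set B).

Lemma leb8_cube8 c : 0 < c -> leb8 R (cube8 (centered c)) = ((2 * c) ^+ 8)%:E.
Proof.
move=> c0; apply: (product_measure_cube8 (mu := Defs.leb R)); first exact: measurable_itv.
transitivity (lebesgue_measure (`[- c, c]%classic : set R)); first by [].
by rewrite lebesgue_measure_itv /= lte_fin gtrN // -EFinB opprK mulr2n mulrDl mul1r.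
Qed.

Lemma leb8_ball8_gt0 : 0 < fine (leb8 R ball8).
Proof.
have mb := measurable_ball8; rewrite ball8E in mb *; set b := [set p | _] in mb *.
have mc c : measurable (cube8 (centered c)) by apply: measurable_cube8; exact: measurable_itv.
have c4 : cube8 (centered 4^-1) `<=` b.
  have sq (x : R) : x \in `[- 4^-1, 4^-1] -> x ^+ 2 <= 8^-1.
    rewrite in_itv /= => /andP[xl xu]; rewrite -subr_ge0.
    have : 0 <= (x + 4^-1) * (4^-1 - x).
      by rewrite mulr_ge0 // ?subr_ge0 // -lerBlDr sub0r.
    lra.
  move=> [[[[[[[x0 x1] x2] x3] x4] x5] x6] x7]; rewrite /cube8 /=.
  move=> [[[[[[[/sq ? /sq ?] /sq ?] /sq ?] /sq ?] /sq ?] /sq ?] /sq ?].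
  by rewrite /b /sum8 /=; lra.
have c1 : b `<=` cube8 (centered 1).
  have sq (x : R) : x ^+ 2 <= 1 -> x \in `[- 1, 1].
    by move=> xx; rewrite in_itv /=; apply/andP; split; nra.
  move=> [[[[[[[x0 x1] x2] x3] x4] x5] x6] x7]; rewrite /b /sum8 /= => H.
  have := (sqr_ge0 x0, sqr_ge0 x1, sqr_ge0 x2, sqr_ge0 x3).
  have := (sqr_ge0 x4, sqr_ge0 x5, sqr_ge0 x6, sqr_ge0 x7).
  move=> [[[h4 h5] h6] h7] [[[h0 h1] h2] h3].
  by rewrite /cube8 /=; repeat split; apply: sq; lra.
have l1 : (leb8 R b <= leb8 R (cube8 (centered 1)))%E by apply: le_measure => //; rewrite inE.
have l4 : (leb8 R (cube8 (centered 4^-1)) <= leb8 R b)%E by apply: le_measure => //; rewrite inE.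
rewrite leb8_cube8 // in l1; rewrite leb8_cube8 ?invr_gt0 // in l4.
apply: fine_gt0; apply/andP; split.
  by apply: lt_le_trans l4; rewrite lte_fin exprn_gt0 //; lra.
exact: le_lt_trans l1 (ltry _).
Qed.

Lemma round_integral_cst (c : R) :
  round_integral (fun=> c) = 8 * (c * fine (leb8 R ball8)).
Proof. by rewrite /round_integral Rintegral_cst //; exact: measurable_ball8. Qed.
End Ball.

(** * Second variation *)

Lemma second_derivative (R : realType) (c d A B n : R) : 0 <= n -> A * B = 0 ->
  derive1 (fun s => derive1 (fun t =>
    c + d * ((A + (s + t) * B) ^+ 2 / (1 + (s + t) ^+ 2 * n))) 0) 0
  = 2 * d * (B ^+ 2 - A ^+ 2 * n).
Proof.
move=> n0 AB.
have den (u : R) : 1 + u ^+ 2 * n != 0.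
  by rewrite gt_eqF // ltr_pwDl // mulr_ge0 // sqr_ge0.
have num (u : R) : (A + u * B) ^+ 2 = A ^+ 2 + u ^+ 2 * B ^+ 2.
  by rewrite sqrrD mulrCA AB mulr0 mul0rn addr0 exprMn.
pose k := 2 * d * (B ^+ 2 - A ^+ 2 * n).
have -> : (fun s => derive1 (fun t => c + d * ((A + (s + t) * B) ^+ 2 / (1 + (s + t) ^+ 2 * n))) 0)
   = (fun s => k * s * (1 + s ^+ 2 * n)^-1 ^+ 2).
  apply/funext => s; rewrite derive1E.
  pose N (t : R) := A ^+ 2 + (s + t) ^+ 2 * B ^+ 2.
  pose D (t : R) := 1 + (s + t) ^+ 2 * n.
  have dN : is_derive (0 : R) (1 : R) N (2 * s * B ^+ 2).
    by apply: is_derive_eq; rewrite /GRing.scale /=; ring.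
  have dD : is_derive (0 : R) (1 : R) D (2 * s * n).
    by apply: is_derive_eq; rewrite /GRing.scale /=; ring.
  have dV : is_derive (0 : R) (1 : R) (fun t => (D t)^-1) (- (D 0) ^- 2 *: (2 * s * n)).
    by apply: is_deriveV; exact: den.
  rewrite (_ : (fun t => _) = (fun t => c + d * (N t * (D t)^-1))); last first.
    by apply/funext => t; rewrite num.
  have dF : is_derive (0 : R) (1 : R) (fun t => c + d * (N t * (D t)^-1))
     (k * s * (1 + s ^+ 2 * n)^-1 ^+ 2).
    apply: is_derive_eq; rewrite /GRing.scale /= /N /D !addr0 /k; field; exact: den.
  exact: derive_val.
rewrite derive1E.
pose D (s : R) := 1 + s ^+ 2 * n.
have dD : is_derive (0 : R) (1 : R) D 0.
  by apply: is_derive_eq; rewrite /GRing.scale /=; ring.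
have dV : is_derive (0 : R) (1 : R) (fun t => (D t)^-1) (- (D 0) ^- 2 *: 0).
  by apply: is_deriveV; exact: den.
have D0 : D 0 = 1 by rewrite /D expr0n mul0r addr0.
have dF : is_derive (0 : R) (1 : R) (fun s => k * s * (D s)^-1 ^+ 2) k.
  by apply: is_derive_eq; rewrite D0 /GRing.scale /= invr1; ring.
exact: derive_val.
Qed.

Section Index.
Variables (R : realType) (r : R).
Hypothesis r0 : 0 < r.
Local Notation H := (quat R).
Local Notation M2 := ('M[quat R]_2).
Let rn0 : r != 0 := lt0r_neq0 r0.

(* Unqualified, harmonic is the harmonic sequence of MathComp-Analysis. *)
Lemma harmonic_phi (h : H) :
  S3 h -> q2 h = 0 \/ [/\ q0 h = 0, q1 h = 0 & q3 h = 0] ->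
  Defs.harmonic r (phi r h).
Proof.
move=> hS hh a aS m.
have T b : Sp2 b -> torsion r (phi r h) b = torsion_mx r h 0 0 0.
  move=> bS; apply: torsion_phi => // i j k l.
  exact: (@frame_deriv_eq0 _ i _ _ (phi r h b j k l)).
rewrite -[RHS](div_torsion_mx 0 0 0 rn0 hS m hh) /div_torsion T //.
apply: eq_bigr => i _; congr (_ * (_ + _)).
by rewrite (@frame_deriv_eq0 _ i _ _ (torsion_mx r h 0 0 0 i m)) ?sub0r // => b /T ->.
Qed.

Definition energy_cst : R := 16 * r * fine (leb8 R (@ball8 R)).

Lemma energy_cst_gt0 : 0 < energy_cst.
Proof. by rewrite !mulr_gt0 // leb8_ball8_gt0. Qed.

Lemma energy_variation (h : H) y1 y2 y3 : S3 h ->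
  energy r (isometric_variation r (phi r h)
    (right_mul (Quat 0 (2 * y1) (2 * y2) (2 * y3)))) =
  energy_cst * (19 * r ^- 2 - 14 * r + 4 * r ^+ 4)
  + energy_cst * (8 * (r ^+ 4 + r - 2 * r ^- 2)) *
    ((q2 h + r * q2 (h * Quat 0 y1 y2 y3)) ^+ 2 / (1 + sqnorm r y1 y2 y3)).
Proof.
move=> hS; set f := isometric_variation _ _ _; set h' := moved r h y1 y2 y3.
have hS' : S3 h' by exact: S3_moved.
have fE b : Sp2 b -> f b = phi r h' b.
  move=> bS; apply/funext => i; apply/funext => j; apply/funext => k.
  apply: (@variation_phi _ _ _ _ _ _ rn0 hS (phi r h)) => // m.
  rewrite field_coord_right_mul //.
  by case: m => [[|[|[|[|[|[|[|//]]]]]]] ?] /=; rewrite ?mulr0.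
pose c := 19 * r ^- 2 - 14 * r + 4 * r ^+ 4
  + 8 * (r ^+ 4 + r - 2 * r ^- 2) * q2 h' ^+ 2.
have fT b : Sp2 b -> torsion_norm2 r f b = c.
  move=> bS.
  rewrite (@torsion_norm2_phi _ _ _ 0 0 0 rn0 hS' f b (fE b bS)) // => i j k l.
  by apply: (@frame_deriv_eq0 _ i _ _ (phi r h' b j k l)) => // b' /fE ->.
rewrite /energy (_ : (fun x => _) = fun=> c); last first.
  by apply/funext => x; apply: fT; exact: Sp2_Sp2_lift.
rewrite round_integral_cst /energy_cst /c q2_moved_sqr.
by move: (_ ^+ 2 / (1 + _)) (fine _) => A B; field.
Qed.

Lemma hessian_right_mul (h : H) y1 y2 y3 :
  S3 h -> q2 h * q2 (h * Quat 0 y1 y2 y3) = 0 ->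
  hessian r (phi r h) (right_mul (Quat 0 (2 * y1) (2 * y2) (2 * y3)))
     (right_mul (Quat 0 (2 * y1) (2 * y2) (2 * y3))) =
  2 * (energy_cst * (8 * (r ^+ 4 + r - 2 * r ^- 2))) *
    ((r * q2 (h * Quat 0 y1 y2 y3)) ^+ 2 - q2 h ^+ 2 * sqnorm r y1 y2 y3).
Proof.
move=> hS hy.
rewrite -(@second_derivative R (energy_cst * (19 * r ^- 2 - 14 * r + 4 * r ^+ 4))).
- rewrite /hessian; congr (derive1 _ 0); apply/funext => s.
  congr (derive1 _ 0); apply/funext => t.
  rewrite (_ : (fun x => _) = right_mul (Quat 0 (2 * ((s + t) * y1))
    (2 * ((s + t) * y2)) (2 * ((s + t) * y3)))).
    rewrite energy_variation //; congr (_ + _ * (_ ^+ 2 / (1 + _))).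
      by rewrite /=; ring.
    by rewrite /sqnorm; ring.
  apply/funext => v; rewrite -scalerDl -right_mulZ; congr (right_mul _ v).
  by apply: quat_eq => /=; ring.
- exact: sqnorm_ge0.
- by rewrite mulrCA hy mulr0.
Qed.

Lemma morse_index_ge (f : M2 -> form3 R) n (V : 'I_n -> 'rV[R]_8 -> 'rV[R]_8) :
  neg_def_family r f V -> (n%:R%:E <= morse_index r f)%E.
Proof. by move=> H; apply: ereal_sup_ubound; exists n => //; exists V. Qed.

Lemma sum_sqr3_gt0 (c : 'I_3 -> R) i :
  c i != 0 -> 0 < c 0 ^+ 2 + c 1 ^+ 2 + c 2%:R ^+ 2.
Proof.
rewrite -sqrf_eq0 => ci; have sq j : 0 <= c j ^+ 2 by exact: sqr_ge0.
have E : \sum_j c j ^+ 2 = c 0 ^+ 2 + c 1 ^+ 2 + c 2%:R ^+ 2.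
  rewrite !big_ord_recl big_ord0 addr0 addrA; congr (_ + c _ ^+ 2 + c _ ^+ 2); exact: val_inj.
rewrite -E (bigD1 i) //= ltr_pwDl ?sumr_ge0 // lt_def ci sq //.
Qed.

Lemma mulr2_half (x : R) : x = 2 * (2^-1 * x).
Proof. by rewrite mulVKf // pnatr_eq0. Qed.

Lemma torsion_coefE : r ^+ 4 + r - 2 * r ^- 2 = r ^- 2 * (r ^+ 3 + 2) * (r ^+ 3 - 1).
Proof. by field. Qed.

Definition hessian_coef : R := 2 * (energy_cst * (8 * (r ^- 2 * (r ^+ 3 + 2)))).

Lemma hessian_coef_gt0 : 0 < hessian_coef.
Proof.
have r2 : 0 < r ^- 2 by rewrite invr_gt0 exprn_gt0.
have r3 : 0 < r ^+ 3 + 2 by rewrite addr_gt0 // exprn_gt0.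
have C0 := energy_cst_gt0; apply: mulr_gt0 => //; apply: mulr_gt0 => //.
by apply: mulr_gt0 => //; exact: mulr_gt0.
Qed.

(* y = h^-1 j, so that h (1 + t y) = h + t j leaves the sphere h_2 = 0. *)
Lemma morse_index_RP2 (h : H) : S3 h -> q2 h = 0 -> r < 1 ->
  (1%:R%:E <= morse_index r (phi r h))%E.
Proof.
move=> hS h2 r1; set x := Quat 0 (q3 h) (q0 h) (- q1 h).
have hS' : q0 h ^+ 2 + q1 h ^+ 2 + q2 h ^+ 2 + q3 h ^+ 2 = 1 by exact: hS.
apply: (@morse_index_ge _ 1 (fun=> right_mul x)); split.
- by move=> _; exact: vector_field_right_mul.
- move=> c; rewrite lincomb_right_mul => /right_mul_eq0; rewrite big_ord1 => E i.
  have /= e1 := congr1 (@q1 R) E; have /= e2 := congr1 (@q2 R) E; have /= e3 := congr1 (@q3 R) E.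
  rewrite ord1; transitivity (c 0 * (q0 h ^+ 2 + q1 h ^+ 2 + q2 h ^+ 2 + q3 h ^+ 2)).
    by rewrite hS' mulr1.
  have {}e1 : c 0 * q3 h = 0 by rewrite -[RHS]e1; ring.
  have {}e2 : c 0 * q0 h = 0 by rewrite -[RHS]e2; ring.
  have {}e3 : c 0 * q1 h = 0 by rewrite -[RHS]oppr0 -[X in - X]e3; ring.
  by rewrite h2 !mulrDr !exprS !mulrA e1 e2 e3 !mul0r !mulr0 !mul0r !addr0.
- move=> c [i]; rewrite ord1 => c0; rewrite lincomb_right_mul big_ord1.
  have -> : qreal (c 0) * x = Quat 0 (2 * (2^-1 * (c 0 * q3 h)))
      (2 * (2^-1 * (c 0 * q0 h))) (2 * (2^-1 * - (c 0 * q1 h))).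
    by apply: quat_eq; rewrite /= -?mulr2_half; ring.
  rewrite hessian_right_mul // h2 ?mul0r // expr0n mul0r subr0 torsion_coefE.
  have -> : q2 (h * Quat 0 (2^-1 * (c 0 * q3 h)) (2^-1 * (c 0 * q0 h))
      (2^-1 * - (c 0 * q1 h))) = 2^-1 * c 0.
    transitivity (2^-1 * c 0 * (q0 h ^+ 2 + q1 h ^+ 2 + q2 h ^+ 2 + q3 h ^+ 2)).
      by rewrite h2 /=; ring.
    by rewrite hS' mulr1.
  have r3 : r ^+ 3 - 1 < 0 by rewrite subr_lt0 exprn_ilt1 // ltW.
  have sq0 : 0 < (r * (2^-1 * c 0)) ^+ 2.
    by rewrite exprn_even_gt0 //= !mulf_neq0 // invr_eq0 pnatr_eq0.
  rewrite (_ : _ * _ = hessian_coef * (r * (2^-1 * c 0)) ^+ 2 * (r ^+ 3 - 1)); last first.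
    by rewrite /hessian_coef; ring.
  by rewrite pmulr_rlt0 // mulr_gt0 // hessian_coef_gt0.
Qed.

Lemma morse_index_NS (h : H) : h = Quat 0 0 1 0 \/ h = Quat 0 0 (-1) 0 -> 1 < r ->
  (3%:R%:E <= morse_index r (phi r h))%E.
Proof.
move=> hE r1.
have hS : S3 h by case: hE => ->; rewrite /S3 /=; ring.
have h2 : q2 h ^+ 2 = 1 by case: hE => -> /=; ring.
have [h0 h1 h3] : [/\ q0 h = 0, q1 h = 0 & q3 h = 0] by case: hE => ->.
pose x (i : 'I_3) : H := [:: qi R; qj R; qk R]`_i.
have xE (c : 'I_3 -> R) : \sum_(i < 3) qreal (c i) * x i = Quat 0 (c 0) (c 1) (c 2%:R).
  rewrite !big_ord_recl big_ord0 /x /=.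
  have -> : lift ord0 ord0 = 1 :> 'I_3 by exact: val_inj.
  have -> : lift ord0 (lift ord0 ord0) = 2%:R :> 'I_3 by exact: val_inj.
  by apply: quat_eq => /=; ring.
apply: (@morse_index_ge _ 3 (fun i => right_mul (x i))); split.
- by case=> [[|[|[|//]]] ?]; exact: vector_field_right_mul.
- move=> c; rewrite lincomb_right_mul xE => /right_mul_eq0 E.
  have /= e1 := congr1 (@q1 R) E; have /= e2 := congr1 (@q2 R) E; have /= e3 := congr1 (@q3 R) E.
  by case=> [[|[|[|//]]] ?]; [rewrite -[RHS]e1|rewrite -[RHS]e2|rewrite -[RHS]e3];
    congr c; exact: val_inj.
- move=> c [i c0]; rewrite lincomb_right_mul xE.
  rewrite [c 0]mulr2_half [c 1]mulr2_half [c 2%:R]mulr2_half hessian_right_mul //; last first.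
    by rewrite /= h0 h1 h3; ring.
  rewrite torsion_coefE h2 mul1r.
  have -> (a b d : R) : q2 (h * Quat 0 a b d) = 0 by rewrite /= h0 h1 h3; ring.
  have r3 : 0 < r ^+ 3 - 1 by rewrite subr_gt0 exprn_egt1.
  set n := sqnorm _ _ _ _.
  have n0 : 0 < n.
    rewrite /n /sqnorm mulr_gt0 ?exprn_gt0 //.
    apply: (@sum_sqr3_gt0 (fun i => 2^-1 * c i) i).
    by rewrite mulf_neq0 // invr_eq0 pnatr_eq0.
  rewrite (_ : _ * _ = - (hessian_coef * n * (r ^+ 3 - 1))); last first.
    by rewrite /hessian_coef; ring.
  by rewrite oppr_lt0; apply: mulr_gt0 => //; exact: mulr_gt0 hessian_coef_gt0 n0.
Qed.

End Index.

Theorem theorem5 (R : realType) (r : R) (hr : 0 < r) :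
  (r < 1 ->
     forall h : quat R, S3 h -> q2 h = 0 ->
       (1%:E <= morse_index r (phi r h))%E /\ unstable r (phi r h)) /\
  (1 < r ->
     forall h : quat R, h = Quat 0 0 1 0 \/ h = Quat 0 0 (-1) 0 ->
       (3%:E <= morse_index r (phi r h))%E /\ unstable r (phi r h)).
Proof.
split=> [r1 h hS h2|r1 h hE].
- have I1 := morse_index_RP2 hr hS h2 r1; split=> //; split.
    by apply: harmonic_phi => //; left.
  by apply: lt_le_trans I1; rewrite lte_fin.
- have I3 := morse_index_NS hr hE r1; split=> //; split.
    apply: harmonic_phi => //; first by case: hE => ->; rewrite /S3 /=; ring.
    by right; case: hE => ->.
  by apply: lt_le_trans I3; rewrite lte_fin.
Qed.
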